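(* For every $h\in(0,h_2)$ the discrete solution operator $S_h: B_{L^2(\Omega)}(\bar u,\rho)\to \overline B_{W^{1,\tilde p}_0(\Omega)}(\bar y,\kappa_\rho)\cap V_h$ is of class $C^1$. Moreover, for every $u\in B_{L^2(\Omega)}(\bar u,\rho)$ and $v\in L^2(\Omega)$, writing $y_h(u):=S_h(u)$, the Fréchet derivative $z_h:=S_h'(u)v\in V_h$ is the unique solution of $$\int_\Omega\big[(b+a(y_h(u)))\nabla z_h+\mathbf 1_{\{y_h(u)\ne\bar t\}}a'(y_h(u))\,z_h\nabla y_h(u)\big]\cdot\nabla w_h\,dx=\int_\Omega v w_h\,dx\qquad\text{for all } w_h\in V_h.$$
   Context: Setting: $\Omega\subset\mathbb R^2$ is an open bounded convex polygonal domain. $b:\overline\Omega\to\mathbb R$ is Lipschitz continuous with $b(x)\ge\underline b>0$ for all $x\in\overline\Omega$. $a:\mathbb R\to[0,\infty)$ is given by $a(t)=a_0(t)$ for $t\le\bar t$ and $a(t)=a_1(t)$ for $t>\bar t$, where $\bar t\in\mathbb R$, $a_0\in C^2((-\infty,\bar t])$, $a_1\in C^2([\bar t,\infty))$, $a_0(\bar t)=a_1(\bar t)$. $\mathbf 1_A$ is the characteristic function of $A$, and $\mathbf 1_{\{y\neq\bar t\}}a'(y)$ is understood to be $0$ on $\{y=\bar t\}$. $B_X(x,r)$ and $\overline B_X(x,r)$ are the open and closed balls in $X$. For $u\in L^2(\Omega)$, $S(u)=y_u\in H^1_0(\Omega)$ denotes the unique weak solution of $-\mathrm{div}[(b+a(y_u))\nabla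 y_u]=u$ in $\Omega$, $y_u=0$ on $\partial\Omega$ (one has $S(u)\in W^{1,p}_0(\Omega)$ for all $p>2$). Finite elements: $\{\mathcal T_h\}_{h>0}$ is a family of triangulations of $\overline\Omega=\bigcup_{T\in\mathcal T_h}T$ with $h=\max_{T\in\mathcal T_h}\varrho(T)$, regular in the sense that there are $\bar\varrho,\bar\delta>0$ with $\varrho(T)/\delta(T)\le\bar\delta$ and $h/\varrho(T)\le\bar\varrho$ for all $T\in\mathcal T_h$, $h>0$, where $\varrho(T)$ is the diameter of $T$ and $\delta(T)$ the diameter of the largest ball contained in $T$. $V_h:=\{v_h\in C(\overline\Omega): v_h|_T\in\mathcal P_1\ \forall T\in\mathcal T_h,\ v_h=0\text{ on }\partial\Omega\}$, with $\mathcal P_1$ the polynomials of degree at most $1$. The discrete state equation for $y_h\in V_h$ is $\int_\Omega(b+a(y_h))\nabla y_h\cdot\nabla v_h\,dx=\int_\Omega u v_h\,dx$ for all $v_h\in V_h$. Fix $\bar u\in L^2(\Omega)$, $\bar y:=S(\bar u)$ and $\tilde p\ge4$. The constants $h_1,\rho,\kappa_\rho>0$ are fixed such that for all $h<h_1$ and $u\in\overline B_{L^2(\Omega)}(\bar u,\rho)$ the discrete state equation has a unique solution, denoted $S_h(u)$ (or $y_h(u)$), in $\overline B_{W^{1,\tilde p}_0(\Omega)}(\bar y,\kappa_\rho)\cap V_h$ (such constants are known to exist). For $h\in(0,h_1)$ and $y_h\in V_h$ define $D_{h,y_h}:V_h\to V_h^*$ by $\langle D_{h,y_h}w_h,z_h\rangle:=\int_\Omega[(b+a(y_h))\nabla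 w_h+\mathbf 1_{\{y_h\ne\bar t\}}a'(y_h)\nabla y_h\,w_h]\cdot\nabla z_h\,dx$. The constant $h_2\in(0,h_1)$ is such that $D_{h,y_h}$ is an isomorphism for all $h\in(0,h_2)$ and all $y_h\in\overline B_{W^{1,\tilde p}_0(\Omega)}(\bar y,\kappa_\rho)\cap V_h$ (such a constant exists). *)

(* Defs.v *)
From HB Require Import structures.
From mathcomp Require Import all_boot all_order all_algebra.
From mathcomp Require Import all_classical all_reals all_analysis.

Set Implicit Arguments.
Unset Strict Implicit.
Unset Printing Implicit Defensive.

Import Order.TTheory GRing.Theory Num.Theory.
Import numFieldNormedType.Exports.

Local Open Scope classical_set_scope.
Local Open Scope ring_scope.

(* The library norm on [R * R] is the sup norm; it is used only where the choice
   of norm is immaterial (topology, boundedness, Lipschitz continuity).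
   Lengths are measured with [edist]. *)

Section PlaneGeometry.
Context {R : realType}.
Implicit Types (x y : R * R) (A : set (R * R)).

Definition dot x y : R := x.1 * y.1 + x.2 * y.2.

Definition edist x y : R := Num.sqrt (dot (x - y) (x - y)).

Definition diam A : R := sup [set edist x y | x in A & y in A].

Definition inball_diam A : R :=
  sup [set d | exists r c,
    [/\ 0 <= r, [set x | edist c x <= r] `<=` A & d = 2 * r]].

Definition conv_hull (s : seq (R * R)) : set (R * R) :=
  [set x | exists l : 'I_(size s) -> R,
    [/\ forall i, 0 <= l i, \sum_i l i = 1 & x = \sum_i l i *: s`_i]].

Definition convex_polygon A : Prop :=
  [/\ A !=set0, open A, bounded_set A, convex_set A &
      exists s : seq (R * R), closure A = conv_hull s].

End PlaneGeometry.

Section LebesgueSobolev.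
Context {R : realType}.
Implicit Types (W : set (R * R)) (p : R) (v u w : R * R -> R)
  (dv : R * R -> R * R).

Definition mu2 : {measure set (measurableTypeR R * measurableTypeR R) -> \bar R}
  := (@lebesgue_measure R \x @lebesgue_measure R)%E.

(* Elements of L^p(W) are represented by functions on the whole plane of which
   only the restriction to W matters. *)
Definition Lp W p : set (R * R -> R) :=
  [set v | (v \_ W : measurableTypeR R * measurableTypeR R -> R)
             \in Lfun mu2 p%:E].

Definition Lpnorm W p v : \bar R :=
  ('N[mu2]_p%:E [EFin \o (v \_ W)])%E.

Definition integral2 W v : R :=
  \int[mu2]_(x in (W : set (measurableTypeR R * measurableTypeR R))) v x.

Definition integrable2 W v : Prop :=
  mu2.-integrable (W : set (measurableTypeR R * measurableTypeR R))
    (EFin \o v).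

(* false: derivative in the first variable, true: in the second *)
Definition axis (i : bool) : R * R := if i then (0, 1) else (1, 0).
Definition partial (i : bool) v : R * R -> R := fun x => 'D_(axis i) v x.
Definition xcoord (i : bool) (x : R * R) : R := if i then x.2 else x.1.
Definition grad v : R * R -> R * R :=
  fun x => (partial false v x, partial true v x).

Definition smooth v : Prop :=
  forall s : seq bool, let g := foldr partial v s in
    continuous g /\ forall i x, derivable g x (axis i).

(* C_c^oo(W) *)
Definition test_fun W v : Prop :=
  [/\ smooth v, compact (closure [set x | v x != 0]) &
      closure [set x | v x != 0] `<=` W].

Definition weak_grad W v dv : Prop :=
  forall phi, test_fun W phi -> forall i,
    integral2 W (fun x => v x * partial i phi x) =
    - integral2 W (fun x => xcoord i (dv x) * phi x).

(* The W^{1,p}(W) norm of the function v whose (weak) gradient is dv. *)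
Definition W1norm W p v dv : \bar R :=
  (Lpnorm W p v + Lpnorm W p (fst \o dv) + Lpnorm W p (snd \o dv))%E.

(* v is in W^{1,p}_0(W), the closure of C_c^oo(W) in W^{1,p}(W), and dv is its
   weak gradient (which is unique almost everywhere). *)
Definition W1p0 W p v dv : Prop :=
  [/\ Lp W p v, Lp W p (fst \o dv), Lp W p (snd \o dv), weak_grad W v dv &
      exists phi : nat -> R * R -> R, (forall n, test_fun W (phi n)) /\
        W1norm W p (phi n - v) (grad (phi n) - dv) @[n --> \oo] --> 0%E].

End LebesgueSobolev.

Section Nonlinearity.
Context {R : realType}.

(* difference quotients are taken within D, hence one-sided at the endpoints *)
Definition has_deriv_on (D : set R) (f f' : R -> R) : Prop :=
  forall t, D t ->
    (f s - f t) / (s - t) @[s --> within D (t^')] --> f' t.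

Definition C2_on (D : set R) (f : R -> R) : Prop :=
  exists f1 f2, [/\ has_deriv_on D f f1, has_deriv_on D f1 f2 &
                    {within D, continuous f2}].

Definition piecewise (tbar : R) (a0 a1 : R -> R) : R -> R :=
  fun t => if t <= tbar then a0 t else a1 t.

(* the function 1_{t <> tbar} a'(t) *)
Definition deriv_off (tbar : R) (a : R -> R) : R -> R :=
  fun t => if t == tbar then 0 else derive1 a t.

End Nonlinearity.

Section StateEquation.
Context {R : realType}.
Variables (W : set (R * R)) (b : R * R -> R) (a : R -> R).

(* y in H^1_0(W), with weak gradient dy, solves -div((b + a(y)) grad y) = u
   weakly. *)
Definition weak_solution (u y : R * R -> R) (dy : R * R -> R * R) : Prop :=
  W1p0 W 2 y dy /\
  forall w dw, W1p0 W 2 w dw ->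
    let flux := fun x => (b x + a (y x)) * dot (dy x) (dw x) in
    integrable2 W flux /\
    integral2 W flux = integral2 W (fun x => u x * w x).

End StateEquation.

Section FiniteElements.
Context {R : realType}.
Implicit Types (W : set (R * R)) (M : seq (3.-tuple (R * R))).

(* A triangle is given by its vertices.  In a conforming mesh two triangles meet
   exactly in the hull of their common vertices: nothing, a vertex, an edge, or
   the whole triangle. *)
Definition triangulation W M : Prop :=
  [/\ forall T, T \in M -> interior (conv_hull T) !=set0,
      \bigcup_(T in [set` M]) conv_hull T = closure W &
      forall T T', T \in M -> T' \in M ->
        conv_hull T `&` conv_hull T' = conv_hull [seq x <- T | x \in tval T']].

Definition mesh_size M : R := \big[Num.max/0]_(T <- M) diam (conv_hull T).

(* The family is indexed by its set H of mesh sizes: since h is the largest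
   diameter of a triangle of [Th h], it cannot exceed the diameter of W, so that
   H cannot be the whole of ]0, +oo[. *)
Definition regular_family W (H : set R) (Th : R -> seq (3.-tuple (R * R)))
    : Prop :=
  (forall h, H h -> [/\ 0 < h, triangulation W (Th h) & h = mesh_size (Th h)])
  /\
  exists rhobar deltabar : R, [/\ 0 < rhobar, 0 < deltabar &
    forall h, H h -> forall T, T \in Th h ->
      diam (conv_hull T) / inball_diam (conv_hull T) <= deltabar /\
      h / diam (conv_hull T) <= rhobar].

(* P1 elements vanishing on the boundary, extended by zero to the plane, so that
   equality of elements of V_h is equality of functions.  They are affine on each
   of finitely many triangles, so that [grad] gives their classical gradient off
   the null set of edges, and this is their weak gradient. *)
Definition Vh W M : set (R * R -> R) :=
  [set v | [/\ {within closure W, continuous v},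
      forall T, T \in M -> exists (c : R) (g : R * R),
        forall x, conv_hull T x -> v x = c + dot g x &
      forall x, ~ W x -> v x = 0]].

Definition Vball W M (p : R) (y : R * R -> R) (dy : R * R -> R * R) (k : R)
    : set (R * R -> R) :=
  [set v | Vh W M v /\ (W1norm W p (v - y)%R (grad v - dy)%R <= k%:E)%E].

Definition discrete_state W M (b : R * R -> R) (a : R -> R)
    (u y : R * R -> R) : Prop :=
  forall w, Vh W M w ->
    integral2 W (fun x => (b x + a (y x)) * dot (grad y x) (grad w x)) =
    integral2 W (fun x => u x * w x).

(* <D_{h,y} z, w> ; da stands for 1_{. <> tbar} a' *)
Definition Dform W (b : R * R -> R) (a da : R -> R) (y z w : R * R -> R) : R :=
  integral2 W (fun x =>
    dot ((b x + a (y x)) *: grad z x + (da (y x) * z x) *: grad y x)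
        (grad w x)).

Definition linear_on (X : set (R * R -> R)) (V : lmodType R)
    (l : (R * R -> R) -> V) : Prop :=
  forall (c : R) v w, X v -> X w -> l (c *: v + w) = c *: l v + l w.

(* D_{h,y} : V_h -> V_h^* is bijective; V_h being finite dimensional, V_h^*
   consists of all linear functionals and boundedness is automatic. *)
Definition D_iso W M (b : R * R -> R) (a da : R -> R) (y : R * R -> R) : Prop :=
  forall l : (R * R -> R) -> R^o, linear_on (Vh W M) l ->
    exists! z, Vh W M z /\
      forall w, Vh W M w -> Dform W b a da y z w = l w.

End FiniteElements.

(* X and Y are subspaces of functions with (semi)norms nX and nY.  Representing
   L^2 by functions rather than by classes costs nothing: a linear map bounded
   for the seminorm nX only depends on the class. *)
Section FrechetDerivative.
Context {R : realType}.
Let E : Type := (R * R -> R).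
Variables (X Y : set E) (nX nY : E -> \bar R).

Definition bounded_linear (L : E -> E) : Prop :=
  [/\ forall v, X v -> Y (L v), linear_on X L &
      exists C : R, forall v, X v -> (nY (L v) <= C%:E * nX v)%E].

Definition frechet_deriv (F : E -> E) (u : E) (L : E -> E) : Prop :=
  bounded_linear L /\
  forall e : R, 0 < e -> exists2 d : R, 0 < d &
    forall v, X v -> (nX v < d%:E)%E ->
      (nY (F (u + v) - F u - L v)%R <= e%:E * nX v)%E.

(* F is of class C^1 on the open set U, with derivative dF *)
Definition C1_with (U : set E) (F : E -> E) (dF : E -> E -> E) : Prop :=
  (forall u, U u -> frechet_deriv F u (dF u)) /\
  forall u, U u -> forall e : R, 0 < e -> exists2 d : R, 0 < d &
    forall u', U u' -> (nX (u' - u)%R < d%:E)%E ->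
      forall v, X v -> (nY (dF u' v - dF u v)%R <= e%:E * nX v)%E.

End FrechetDerivative.

Definition L2ball (R : realType) (W : set (R * R)) (u0 : R * R -> R) (r : R)
    : set (R * R -> R) :=
  [set u | Lp W 2 u /\ (Lpnorm W 2 (u - u0)%R < r%:E)%E].

Definition L2cball (R : realType) (W : set (R * R)) (u0 : R * R -> R) (r : R)
    : set (R * R -> R) :=
  [set u | Lp W 2 u /\ (Lpnorm W 2 (u - u0)%R <= r%:E)%E].

(* Main.v *)
Require Import Defs.
From mathcomp Require Import all_boot all_order all_algebra.
From mathcomp Require Import all_classical all_reals all_analysis.
From mathcomp Require Import measurable_realfun ring lra.

Import Order.TTheory GRing.Theory Num.Theory.
Import numFieldNormedType.Exports.

Local Open Scope classical_set_scope.
Local Open Scope ring_scope.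

(** Once a basis of [Vh] is chosen, the discrete state equation becomes a square
    system [F x = load u] for the coordinates [x] of the state, and the theorem
    is about inverting a map [F] of R^n.

    [F] is continuously differentiable although [a] is not.  The kink of [a] is
    felt only where the state takes the value [tbar].  A finite element function
    is affine on every triangle, so up to a null set this happens only on
    triangles where its gradient vanishes; there the product a'(y) z grad y is
    zero whatever value a' is given, and it stays small for nearby states.
    Bounded convergence turns this pointwise remark into differentiability of
    [F] ([state_fun_diff]) and continuity of its Jacobian ([state_jac_near]).
    The Jacobian is the matrix of [Dform], hence invertible at every state in
    the ball ([D_iso_unit]).

    A state may lie on the boundary of the ball, where a local solution branch
    could leave it; so the inverse is controlled by compactness.  The coordinate
    vectors of the functions in [Vball] form a compact set ([compact_Vball]), on
    which [F] takes each value [load u] exactly once; hence the solution depends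
    continuously on [load u] ([inverse_continuous]).  Given continuity, the
    first order expansion of [F] can be solved for the increment of the state
    ([inverse_diff]), and inverse matrices depend continuously on the matrix
    ([inverse_jacobian_continuous]).  The compact set is closed by Minkowski's
    inequality; it is bounded because the norm of [Vh] bounds the coordinates:
    an invertible linearized form recovers them from integrals that Hoelder's
    inequality bounds ([coord_le_shape_norm]).

    The gradient of a finite element function is its classical derivative,
    whose values on the edges of the mesh are uncontrolled.  The edges form a
    null set, and changing a function on a null set does not change its
    integral, measurable or not ([integral_eq_off_null]).  All integrals are
    therefore computed over [mesh_interior], an open set on which the gradient
    is locally constant. *)

Set Implicit Arguments.
Unset Strict Implicit.
Unset Printing Implicit Defensive.

(** * Integrals and null sets *)

Section NullSets.
Context d (T : measurableType d) (R : realType) (mu : {measure set T -> \bar R}).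
Local Open Scope ereal_scope.
Import HBNNSimple.

(** The functions may be non-measurable: the integral is a supremum over simple
    functions, and a simple function below [f], once set to zero on [N], is below
    [g] and has the same integral. *)
Lemma ge0_integral_eq_off_null (N : set T) (f g : T -> \bar R) :
  measurable N -> mu N = 0 -> (forall x, 0 <= f x) -> (forall x, 0 <= g x) ->
  (forall x, ~ N x -> f x = g x) ->
  \int[mu]_x f x = \int[mu]_x g x.
Proof.
move=> mN N0 f0 g0 fg.
suff le u v : (forall x, 0 <= u x) -> (forall x, 0 <= v x) ->
    (forall x, ~ N x -> u x = v x) -> \int[mu]_x u x <= \int[mu]_x v x.
  by apply/eqP; rewrite eq_le !le// => x /fg ->.
move=> {f g f0 g0 fg} u0 v0 uv.
rewrite !ge0_integralTE//; apply: ge_ereal_sup => _ [s /= su <-].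
have mNC : measurable (~` N) by exact: measurableC.
apply: le_ereal_sup_tmp; exists (sintegral mu (proj_nnsfun s mNC)).
  exists (proj_nnsfun s mNC) => // x.
  rewrite -mrestrict patchE; case: ifPn => // /set_mem Nx.
  by rewrite -uv.
rewrite -!integralT_nnsfun.
rewrite (ge0_negligible_integral mN)// ; last 2 first.
- exact/measurable_EFinP.
- by move=> x _; rewrite lee_fin.
rewrite setTD [leLHS]integral_mkcond.
rewrite le_eqVlt; apply/orP; left; apply/eqP.
apply: eq_integral => x _ /=.
by rewrite !patchE mindicE; case: ifPn; rewrite (mulr1, mulr0).
Qed.

Lemma integral_eq_off_null (N D E : set T) (f g : T -> \bar R) :
  measurable N -> mu N = 0 -> (forall x, ~ N x -> (f \_ D) x = (g \_ E) x) ->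
  \int[mu]_(x in D) f x = \int[mu]_(x in E) g x.
Proof.
move=> mN N0 fg; rewrite integral_mkcond [RHS]integral_mkcond.
rewrite [LHS]integralE [RHS]integralE; congr (_ - _);
  by apply: (ge0_integral_eq_off_null mN N0) => // x /fg;
  rewrite ?funeposE ?funenegE => ->.
Qed.

Lemma Rintegral_eq_off_null (N D E : set T) (f g : T -> R) :
  measurable N -> mu N = 0 -> (forall x, ~ N x -> (f \_ D) x = (g \_ E) x) ->
  (\int[mu]_(x in D) f x = \int[mu]_(x in E) g x)%R.
Proof.
move=> mN N0 fg; congr fine; apply: (integral_eq_off_null mN N0) => x /fg.
by rewrite !restrict_EFin /= => ->.
Qed.

Lemma Lnorm_eq_off_null (N : set T) (p : R) (f g : T -> R) :
  measurable N -> mu N = 0 -> (forall x, ~ N x -> f x = g x) ->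
  'N[mu]_p%:E[EFin \o f] = 'N[mu]_p%:E[EFin \o g].
Proof.
move=> mN N0 fg; rewrite unlock; congr (_ `^ _).
apply: (ge0_integral_eq_off_null mN N0) => [x|x|x /fg /= -> //]; exact: poweR_ge0.
Qed.

End NullSets.

Section BoundedConvergence.
Context d (T : measurableType d) (R : realType) (mu : {measure set T -> \bar R}).
Variable D : set T.
Hypotheses (mD : measurable D) (Dfin : (mu D < +oo)%E).

Lemma bounded_integrable (f : T -> R) (C : R) :
  measurable_fun D f -> (forall x, D x -> `|f x| <= C) ->
  mu.-integrable D (EFin \o f).
Proof.
move=> mf fC; apply: (@le_integrable _ _ _ _ _ mD _ (EFin \o cst C)).
- exact/measurable_EFinP.
- move=> x Dx /=; rewrite lee_fin (le_trans (fC x Dx))//; exact: ler_norm.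
- apply/integrableP; split; first exact/measurable_EFinP.
  rewrite (eq_integral (cst `|C|%:E))//.
  by rewrite integral_cst//= lte_mul_pinfty.
Qed.

Lemma bounded_cvg_Rintegral (f_ : nat -> T -> R) (f : T -> R) (C : R) :
  (forall n, measurable_fun D (f_ n)) -> measurable_fun D f ->
  (forall n x, D x -> `|f_ n x| <= C) ->
  {ae mu, forall x, D x -> f_ n x @[n --> \oo] --> f x} ->
  \int[mu]_(x in D) f_ n x @[n --> \oo] --> \int[mu]_(x in D) f x.
Proof.
move=> mf_ mf fC fcvg; apply: fine_cvg.
have [|||||intf _ cvgf] := @dominated_convergence _ _ _ mu D mD
   (fun n => EFin \o f_ n) (EFin \o f) (EFin \o cst `|C|).
- by move=> n; exact/measurable_EFinP.
- exact/measurable_EFinP.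
- apply: filterS fcvg => x xf Dx; apply: cvg_EFin; last exact: xf.
  by near=> n.
- apply: (@bounded_integrable _ `|C|) => // x _; by rewrite normr_id.
- apply: aeW => x n Dx /=; rewrite lee_fin.
  by rewrite (le_trans (fC n x Dx))// ler_norm.
rewrite fineK//; exact: (integrable_fin_num mD intf).
Unshelve. all: by end_near. Qed.

(** If the integrals stayed away from their limit, they would do so along a
    sequence tending to [v0], against bounded convergence. *)
Lemma bounded_continuous_Rintegral (V : normedModType R) (f : V -> T -> R)
    (v0 : V) (C : R) :
  (forall v, `|v - v0| < 1 -> measurable_fun D (f v)) ->
  (forall v x, `|v - v0| < 1 -> D x -> `|f v x| <= C) ->
  {ae mu, forall x, D x -> f v x @[v --> v0] --> f v0 x} ->
  \int[mu]_(x in D) f v x @[v --> v0] --> \int[mu]_(x in D) f v0 x.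
Proof.
move=> mf fC fcvg; apply/cvgrPdist_le => e e0; apply: contrapT => far.
have /choice[v vP] : forall n : nat, exists v, `|v - v0| < n.+1%:R^-1 /\
    e < `|\int[mu]_(x in D) f v0 x - \int[mu]_(x in D) f v x|.
  move=> n; apply: contrapT => /forallNP near_v0; apply: far.
  apply/nbhs_normP; exists n.+1%:R^-1 => //= v.
  rewrite /ball_/= distrC => vn; rewrite leNgt; apply/negP => ev.
  by apply: (near_v0 v).
have v1 n : `|v n - v0| < 1.
  by rewrite (lt_le_trans (vP n).1)// invf_le1// ler1n.
have vcvg : v n @[n --> \oo] --> v0.
  apply/cvgrPdist_lt => r r0; near=> n; rewrite distrC (lt_trans (vP n).1)//.
  by near: n; exact: near_infty_natSinv_lt (PosNum r0).
have mf0 : measurable_fun D (f v0) by apply: mf; rewrite subrr normr0.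
have : \int[mu]_(x in D) f (v n) x @[n --> \oo] --> \int[mu]_(x in D) f v0 x.
  apply: (@bounded_cvg_Rintegral _ _ C) => // [n|n x|].
  - exact: mf.
  - exact: fC.
  - by apply: filterS fcvg => x + Dx => /(_ Dx); exact: cvg_comp.
move/cvgrPdist_le => /(_ _ e0)[N _ /(_ N (leqnn N))].
by rewrite leNgt (vP N).2.
Unshelve. all: by end_near. Qed.

End BoundedConvergence.

(** * A coefficient with a kink *)

Section OneSidedDerivatives.
Context (R : realType).
Implicit Types (D : set R) (f g : R -> R).

(** After multiplication by [s - t] the point [t] itself is no longer exceptional,
    and at an interior point of [D] the restriction to [D] can be dropped. *)
Lemma has_deriv_on_remainder D f f' t (e : R) : has_deriv_on D f f' -> D t ->
  0 < e -> \forall s \near t, D s -> `|f s - f t - f' t * (s - t)| <= e * `|s - t|.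
Proof.
move=> df Dt e0.
have := df t Dt; move=> /cvgrPdist_le/(_ e e0).
rewrite !near_withinE; apply: filterS => s /= near_t Ds.
have [->|s_neq] := eqVneq s t.
  by rewrite !subrr mulr0 subrr normr0 mulr0.
have st0 : s - t != 0 by rewrite subr_eq0.
have := ler_wpM2r (normr_ge0 (s - t)) (near_t s_neq Ds).
by rewrite -normrM mulrBl divfK// distrC.
Qed.

Lemma has_deriv_on_eq D f g f' : (forall t, D t -> f t = g t) ->
  has_deriv_on D f f' -> has_deriv_on D g f'.
Proof.
move=> fg df t Dt; move: (df t Dt); apply: cvg_trans; apply: near_eq_cvg.
by rewrite near_withinE; apply: nearW => s Ds; rewrite !fg.
Qed.

Lemma has_deriv_on_cvg D f f' t (e : R) : has_deriv_on D f f' -> D t ->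
  0 < e -> \forall s \near t, D s -> `|f s - f t| <= e.
Proof.
move=> df Dt e0.
set c := `|f' t| + 1.
have c0 : 0 < c by rewrite ltr_wpDl.
have ec0 : 0 < e / c by rewrite divr_gt0.
near=> s => Ds.
have rem_le : `|f s - f t - f' t * (s - t)| <= 1 * `|s - t|.
  by move: Ds; near: s; exact: has_deriv_on_remainder.
have : `|t - s| <= e / c by near: s; apply: cvgr_dist_le.
rewrite distrC ler_pdivlMr// => /(le_trans _); apply.
have := ler_normD (f s - f t - f' t * (s - t)) (f' t * (s - t)).
by rewrite subrK normrM /c; lra.
Unshelve. all: by end_near. Qed.

Lemma derive_remainderP f t (l : R) :
  (forall e : R, 0 < e -> \forall s \near t, `|f s - f t - l * (s - t)| <= e * `|s - t|) ->
  is_derive t (1 : R) f l.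
Proof.
move=> rem_le.
suff cvgl : h^-1 *: (f (h *: (1 : R) + t) - f t) @[h --> 0^'] --> l.
  by split; [apply: cvgP cvgl|exact: cvg_lim].
apply/cvgrPdist_le => e e0; have := rem_le e e0.
move=> /nbhs_ballP[r /= r0 rle].
rewrite near_withinE; apply/nbhs_ballP; exists r => //= h.
rewrite /ball /= sub0r normrN => hr h0.
have := rle (h + t); rewrite /ball /= opprD addrCA subrr addr0 normrN => /(_ hr).
rewrite addrK => /(ler_wpM2r (normr_ge0 h^-1)).
rewrite [_ *: 1]mulr1 -normrM normfV mulfK ?normr_eq0//.
by rewrite distrC mulrBl mulfK// mulrC.
Qed.

Lemma has_deriv_on_is_derive D f f' t : has_deriv_on D f f' -> nbhs t D ->
  is_derive t (1 : R) f (f' t).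
Proof.
move=> df nD; apply: derive_remainderP => e e0.
have near_rem := has_deriv_on_remainder df (nbhs_singleton nD) e0.
by apply: filterS2 near_rem nD => s /[swap] Ds /(_ Ds).
Qed.

Lemma has_deriv_on_within D f f' : has_deriv_on D f f' -> {within D, continuous f}.
Proof.
move=> df; apply/subspace_continuousP => t Dt; apply/cvgrPdist_le => e e0.
rewrite near_withinE; apply: filterS (has_deriv_on_cvg df Dt e0) => s.
by rewrite distrC.
Qed.

(** The derivative is continuous, hence bounded on [[l, r]]; conclude by the
    mean value theorem. *)
Lemma C2_on_lipschitz D f f1 f2 l r : has_deriv_on D f f1 -> has_deriv_on D f1 f2 ->
  l <= r -> `[l, r]%classic `<=` D ->
  exists2 L : R, 0 <= L & (forall t, l <= t <= r -> `|f1 t| <= L) /\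
    (forall s t, l <= s <= r -> l <= t <= r -> `|f s - f t| <= L * `|s - t|).
Proof.
move=> df df1 lr lrD.
have f1cont : {within `[l, r], continuous f1}.
  exact: continuous_subspaceW lrD (has_deriv_on_within df1).
have [c1 _ f1_max] := EVT_max lr f1cont.
have [c2 _ f1_min] := EVT_min lr f1cont.
exists (`|f1 c1| + `|f1 c2|); first exact: addr_ge0.
have f1_le t : l <= t <= r -> `|f1 t| <= `|f1 c1| + `|f1 c2|.
  move=> tlr; have := f1_max t; have := f1_min t; rewrite !in_itv/= tlr.
  move=> /(_ isT) m1 /(_ isT) m2; rewrite ler_norml.
  have := ler_norm (f1 c1); have := normr_ge0 (f1 c1); have := normr_ge0 (f1 c2).
  by have := ler_norm (- f1 c2); rewrite normrN; lra.
split => // s t.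
wlog st : s t / s <= t.
  move=> H sl tl; have [|/ltW] := leP s t => ?; first exact: H.
  by rewrite distrC (distrC s); exact: H.
move=> /andP[ls sr] /andP[lt tr]; move: st; rewrite le_eqVlt => /predU1P[->|st].
  by rewrite !subrr normr0 mulr0.
have [||c + fst] := @MVT R f f1 s t st.
- move=> x; rewrite in_itv /= => /andP[sx xt].
  apply: has_deriv_on_is_derive df _.
  have : x \in `]s, t[ by rewrite in_itv /= sx.
  move=> /near_in_itvoo; apply: filterS => y; rewrite in_itv/= => /andP[sy yt].
  by apply: lrD; rewrite /= in_itv/=; lra.
- apply: continuous_subspaceW (has_deriv_on_within df).
  by move=> y /=; rewrite in_itv/= => /andP[sy yt]; apply: lrD; rewrite /= in_itv/=; lra.
rewrite in_itv /= => /andP[sc ct].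
rewrite distrC fst normrM (distrC s) ler_wpM2r//.
by apply: f1_le; lra.
Qed.

End OneSidedDerivatives.

(** Only local boundedness is asked of [da] at [tbar]: the integrals below never
    see its value there. *)
Record kinked (R : realType) (tbar : R) (a da : R -> R) : Prop := Kinked {
  kinked_measurable : measurable_fun setT da;
  kinked_lipschitz : forall M : R, exists2 L : R, 0 <= L & forall s t : R,
    `|s| <= M -> `|t| <= M -> `|a s - a t| <= L * `|s - t| /\ `|da s| <= L;
  kinked_diff : forall t, t != tbar -> forall e : R, 0 < e ->
    \forall s \near (0 : R), `|a (t + s) - a t - da t * s| <= e * `|s|;
  kinked_continuous : forall t, t != tbar -> {for t, continuous da} }.

Section PiecewiseCoefficient.
Context (R : realType) (tbar : R) (a0 a1 : R -> R).
Hypotheses (a0_C2 : C2_on [set t | t <= tbar] a0)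
  (a1_C2 : C2_on [set t | tbar <= t] a1) (a01 : a0 tbar = a1 tbar).

Let a := piecewise tbar a0 a1.
Let da := deriv_off tbar a.

Let C2_left : C2_on [set t | t <= tbar] a.
Proof.
case: a0_C2 => [f1 [f2 [df df1 cf2]]]; exists f1, f2; split => //.
by apply: has_deriv_on_eq df => s /= s_le; rewrite /a /piecewise s_le.
Qed.

Let C2_right : C2_on [set t | tbar <= t] a.
Proof.
case: a1_C2 => [f1 [f2 [df df1 cf2]]]; exists f1, f2; split => //.
apply: has_deriv_on_eq df => s /= s_ge; rewrite /a /piecewise; case: leP => // s_le.
by rewrite (_ : s = tbar)//; apply/eqP; rewrite eq_le s_le.
Qed.

Lemma smooth_branch t : t != tbar -> exists D f1 f2, [/\ nbhs t D,
  has_deriv_on D a f1 & has_deriv_on D f1 f2].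
Proof.
rewrite neq_lt => /orP[lt_t|gt_t].
  case: C2_left => [f1 [f2 [df df1 _]]].
  by exists [set t | t <= tbar], f1, f2; split => //; exact: lt_le_nbhsl.
case: C2_right => [f1 [f2 [df df1 _]]].
by exists [set t | tbar <= t], f1, f2; split => //; exact: lt_le_nbhsr.
Qed.

Lemma deriv_off_branch D f1 t : nbhs t D -> has_deriv_on D a f1 -> t != tbar ->
  da t = f1 t.
Proof.
move=> nD df t_neq; rewrite /da /deriv_off (negbTE t_neq) derive1E.
by have isd := has_deriv_on_is_derive df nD; exact: derive_val.
Qed.

(** Two points on the same side of [tbar] are compared on one branch; points on
    opposite sides are compared through [tbar], where the branches agree. *)
Lemma piecewise_lipschitz (M : R) : exists2 L : R, 0 <= L & forall s t : R,
  `|s| <= M -> `|t| <= M -> `|a s - a t| <= L * `|s - t| /\ `|da s| <= L.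
Proof.
case: C2_left => [f1 [f2 [df df1 _]]]; case: C2_right => [g1 [g2 [dg dg1 _]]].
have lr1 : Num.min (- M) tbar <= tbar by rewrite ge_min lexx orbT.
have lr2 : tbar <= Num.max M tbar by rewrite le_max lexx orbT.
have [|L1 L10 [f1_le lip1]] := C2_on_lipschitz df df1 lr1.
  by move=> t /=; rewrite in_itv/= => /andP[].
have [|L2 L20 [g1_le lip2]] := C2_on_lipschitz dg dg1 lr2.
  by move=> t /=; rewrite in_itv/= => /andP[].
exists (L1 + L2); first exact: addr_ge0.
have inl t : `|t| <= M -> t <= tbar -> Num.min (- M) tbar <= t <= tbar.
  by move=> /ler_normlP[tM _] ->; rewrite ge_min lerNl tM.
have inr t : `|t| <= M -> tbar <= t -> tbar <= t <= Num.max M tbar.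
  by move=> /ler_normlP[_ tM] ->; rewrite le_max tM.
have tbl : Num.min (- M) tbar <= tbar <= tbar by rewrite lr1 lexx.
have tbr : tbar <= tbar <= Num.max M tbar by rewrite lr2 lexx.
move=> s t sM tM; split.
  wlog st : s t sM tM / s <= t.
    move=> H; have [|/ltW] := leP s t => ?; first exact: H.
    by rewrite distrC (distrC s); exact: H.
  have st0 : 0 <= `|s - t| by [].
  have [t_le|t_gt] := leP t tbar.
    have := lip1 s t (inl s sM (le_trans st t_le)) (inl t tM t_le).
    by have := mulr_ge0 L20 st0; lra.
  have [s_le|s_gt] := leP s tbar; last first.
    have := lip2 s t (inr s sM (ltW s_gt)) (inr t tM (ltW t_gt)).
    by have := mulr_ge0 L10 st0; lra.
  have := lip1 s tbar (inl s sM s_le) tbl.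
  have := lip2 tbar t tbr (inr t tM (ltW t_gt)).
  have := ler_normD (a s - a tbar) (a tbar - a t); rewrite addrA subrK.
  rewrite (ler0_norm (x := s - t)) ?(ler0_norm (x := s - tbar))
    ?(ler0_norm (x := tbar - t)) ?subr_le0// ?(ltW t_gt)//.
  have := mulr_ge0 L10 (_ : 0 <= t - tbar); have := mulr_ge0 L20 (_ : 0 <= tbar - s).
  by rewrite !subr_ge0 => /(_ s_le) ? /(_ (ltW t_gt)) ?; lra.
have [->|] := eqVneq s tbar.
  by rewrite /da /deriv_off eqxx normr0 addr_ge0.
move=> /[dup] s_neq; rewrite neq_lt => /orP[s_lt|s_gt].
  rewrite (deriv_off_branch _ df)//; last exact: lt_le_nbhsl.
  by rewrite (le_trans (f1_le s (inl s sM (ltW s_lt))))// lerDl.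
rewrite (deriv_off_branch _ dg)//; last exact: lt_le_nbhsr.
by rewrite (le_trans (g1_le s (inr s sM (ltW s_gt))))// lerDr.
Qed.

Lemma piecewise_diff t : t != tbar -> forall e : R, 0 < e ->
  \forall s \near (0 : R), `|a (t + s) - a t - da t * s| <= e * `|s|.
Proof.
move=> t_neq e e0; have [D [f1 [f2 [nD df df1]]]] := smooth_branch t_neq.
rewrite (deriv_off_branch nD df t_neq).
have near_rem := has_deriv_on_remainder df (nbhs_singleton nD) e0.
have : \forall s \near t, `|a s - a t - f1 t * (s - t)| <= e * `|s - t|.
  by apply: filterS2 near_rem nD => s /[swap] Ds /(_ Ds).
move=> /nbhs_ballP[r /= r0 rle]; apply/nbhs_ballP; exists r => //= s.
rewrite /ball /= sub0r normrN => sr.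
have := rle (t + s); rewrite /ball /= [t + s - t]addrC addKr => -> //.
by rewrite opprD addNKr normrN.
Qed.

Lemma deriv_off_continuous t : t != tbar -> {for t, continuous da}.
Proof.
move=> t_neq; have [D [f1 [f2 [nD df df1]]]] := smooth_branch t_neq.
apply/cvgrPdist_le => e e0; rewrite (deriv_off_branch nD df t_neq).
have near_neq : \forall s \near t, s != tbar.
  by apply: open_neq.
have near_f1 := has_deriv_on_cvg df1 (nbhs_singleton nD) e0.
apply: filterS3 near_neq (nbhs_interior nD) near_f1 => s s_neq nsD sle.
by rewrite (deriv_off_branch nsD df s_neq) distrC; apply: sle; exact: nbhs_singleton nsD.
Qed.

Lemma measurable_deriv_off : measurable_fun setT da.
Proof.
rewrite (_ : setT = [set tbar] `|` ~` [set tbar]); last by rewrite setUv.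
apply/measurable_funU => //; first exact: measurableC.
split; first exact: measurable_fun_set1.
apply: open_continuous_measurable_fun.
  have -> : ~` [set tbar] = [set t | t != tbar].
    by apply/seteqP; split => t /= /eqP.
  exact: open_neq.
by move=> t /set_mem /= /eqP; exact: deriv_off_continuous.
Qed.

Lemma piecewise_kinked : kinked tbar a da.
Proof.
split; [exact: measurable_deriv_off|exact: piecewise_lipschitz|
  exact: piecewise_diff|exact: deriv_off_continuous].
Qed.

End PiecewiseCoefficient.

(** * Quasilinear forms on a finite-dimensional space *)

Section DotProduct.
Context (R : realType).
Implicit Types u v w : R * R.

Lemma dotDl u v w : dot (u + v) w = dot u w + dot v w.
Proof. by rewrite /dot /=; ring. Qed.

Lemma dotDr u v w : dot w (u + v) = dot w u + dot w v.
Proof. by rewrite /dot /=; ring. Qed.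

Lemma dotZl c u w : dot (c *: u) w = c * dot u w.
Proof. by rewrite /dot /= /GRing.scale /=; ring. Qed.

Lemma dotZr c u w : dot w (c *: u) = c * dot w u.
Proof. by rewrite /dot /= /GRing.scale /=; ring. Qed.

Lemma dot0l w : dot 0 w = 0.
Proof. by rewrite /dot /= !mul0r addr0. Qed.

Lemma dot_le (u w : R * R) : `|dot u w| <= 2 * `|u| * `|w|.
Proof.
have [u1 u2] : `|u.1| <= `|u| /\ `|u.2| <= `|u|.
  by rewrite ![`|u|]/Num.norm /= !le_max !lexx orbT.
have [w1 w2] : `|w.1| <= `|w| /\ `|w.2| <= `|w|.
  by rewrite ![`|w|]/Num.norm /= !le_max !lexx orbT.
rewrite /dot (le_trans (ler_normD _ _))// !normrM.
have := ler_pM (normr_ge0 _) (normr_ge0 _) u1 w1.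
have := ler_pM (normr_ge0 _) (normr_ge0 _) u2 w2.
by lra.
Qed.

End DotProduct.

Section LinearCombination.
Context (T : Type) (R : realType) (n : nat).
Implicit Types (v : 'I_n -> T -> R) (x : 'rV[R]_n).

Definition comb v x (p : T) : R := \sum_i x 0 i * v i p.

Lemma combD v x z p : comb v (x + z) p = comb v x p + comb v z p.
Proof. by rewrite /comb -big_split; apply: eq_bigr => i _; rewrite mxE mulrDl. Qed.

Lemma combZ v c x p : comb v (c *: x) p = c * comb v x p.
Proof. by rewrite /comb mulr_sumr; apply: eq_bigr => i _; rewrite mxE mulrA. Qed.

Lemma comb_delta v i p : comb v (delta_mx 0 i) p = v i p.
Proof.
rewrite /comb (bigD1 i)//= mxE !eqxx mul1r big1 ?addr0// => j ji.
by rewrite mxE eqxx (negbTE ji) mul0r.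
Qed.

Lemma ler_coord m k (x : 'M[R]_(m, k)) i j : `|x i j| <= `|x|.
Proof.
rewrite [leRHS]/Num.norm /= mx_normrE; exact: (le_bigmax _ (fun ij => `|x ij.1 ij.2|) (i, j)).
Qed.

Lemma mx_norm_le m k (x : 'M[R]_(m, k)) c :
  0 <= c -> (forall i j, `|x i j| <= c) -> `|x| <= c.
Proof.
move=> c0 xc; rewrite [leLHS]/Num.norm /= mx_normrE; apply/bigmax_leP.
by split=> // -[].
Qed.

Lemma linear_row_sum (L : 'rV[R]_n -> R) z :
  (forall c y y', L (c *: y + y') = c * L y + L y') ->
  L z = \sum_j z 0 j * L (delta_mx 0 j).
Proof.
move=> L_lin; rewrite [z in LHS]row_sum_delta.
have L0 : L 0 = 0 by have := L_lin 1 0 0; rewrite scale1r addr0 mul1r; lra.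
elim: (index_enum _) => [|j r IHr]; first by rewrite !big_nil.
by rewrite !big_cons L_lin IHr.
Qed.

Lemma comb_le v x p (B : R) : (forall i, `|v i p| <= B) ->
  `|comb v x p| <= n%:R * B * `|x|.
Proof.
move=> vB; rewrite (le_trans (ler_norm_sum _ _ _))//.
rewrite (@le_trans _ _ (\sum_(i < n) `|x| * B))//.
  apply: ler_sum => i _; rewrite normrM; apply: ler_pM => //; exact: ler_coord.
by rewrite sumr_const card_ord -mulr_natr -[leLHS]mulr_natl; lra.
Qed.

End LinearCombination.

Definition gcomb (T : Type) (R : realType) (n : nat) (g1 g2 : 'I_n -> T -> R)
  (x : 'rV[R]_n) (p : T) : R * R := (comb g1 x p, comb g2 x p).

(** The properties of a basis of the finite element space on which the calculus
    of the quasilinear form rests, with [(g1, g2)] in the place of the gradient.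
    The last field stands in for the differentiability of the coefficient at
    [tbar]. *)
Record shape_family d (T : measurableType d) (R : realType)
    (mu : {measure set T -> \bar R}) (D : set T) (n : nat)
    (phi g1 g2 : 'I_n -> T -> R) (b : T -> R) (tbar B : R) : Prop := ShapeFamily {
  shape_domain : measurable D /\ (mu D < +oo)%E;
  shape_bound_ge0 : 0 <= B;
  shape_measurable_coef : measurable_fun D b;
  shape_coef_le : forall p, D p -> `|b p| <= B;
  shape_measurable : forall i, measurable_fun D (phi i);
  shape_measurable_grad : forall i,
    measurable_fun D (g1 i) /\ measurable_fun D (g2 i);
  shape_le : forall i p, D p -> `|phi i p| <= B;
  shape_grad_le : forall i p, D p -> `|g1 i p| <= B /\ `|g2 i p| <= B;
  shape_off_kink : forall x, {ae mu, forall p, D p ->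
    comb phi x p != tbar \/ gcomb g1 g2 x p = 0} }.

Section QuasilinearForm.
Context d (T : measurableType d) (R : realType) (mu : {measure set T -> \bar R}).
Variables (D : set T) (n : nat) (phi g1 g2 : 'I_n -> T -> R) (b : T -> R).
Variables (a da : R -> R) (tbar B : R).

Hypothesis shapes : shape_family mu D phi g1 g2 b tbar B.
Hypothesis a_kinked : kinked tbar a da.

Let mD : measurable D. Proof. by case: shapes => -[]. Qed.
Let Dfin : (mu D < +oo)%E. Proof. by case: shapes => -[]. Qed.
Let B0 := shape_bound_ge0 shapes.
Let mb := shape_measurable_coef shapes.
Let b_le := shape_coef_le shapes.
Let mphi := shape_measurable shapes.
Let mg1 i := (shape_measurable_grad shapes i).1.
Let mg2 i := (shape_measurable_grad shapes i).2.
Let phi_le := shape_le shapes.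
Let g1_le i p (Dp : D p) := (shape_grad_le shapes i Dp).1.
Let g2_le i p (Dp : D p) := (shape_grad_le shapes i Dp).2.
Let off_kink := shape_off_kink shapes.
Let mda := kinked_measurable a_kinked.
Let a_lip := kinked_lipschitz a_kinked.
Let a_diff := kinked_diff a_kinked.
Let da_cont := kinked_continuous a_kinked.

Lemma a_continuous : continuous a.
Proof.
move=> t; have [L L0 Llip] := a_lip (`|t| + 1).
apply/cvgrPdist_le => e e0; near=> s.
have s1 : `|t - s| <= 1.
  by near: s; apply: cvgr_dist_le.
have sM : `|s| <= `|t| + 1.
  have := ler_normB t (t - s); rewrite opprB addrC subrK; lra.
have [|/le_trans a_le _] := Llip t s _ sM; first by rewrite lerDl.
apply: a_le.
have : `|t - s| <= e / (L + 1).
  by near: s; apply: cvgr_dist_le => //; rewrite divr_gt0// ltr_wpDl.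
rewrite ler_pdivlMr ?ltr_wpDl//.
by have := normr_ge0 (t - s); lra.
Unshelve. all: by end_near. Qed.

Let ma : measurable_fun setT a.
Proof. apply: continuous_measurable_fun; exact: a_continuous. Qed.

(** With y, z, w the combinations of the [phi] with coefficients [x], [z], [w],
    these are the densities of the form (b + a(y)) grad y . grad w and of its
    linearization at y in the direction z. *)
Definition state_int (x w : 'rV[R]_n) (p : T) : R :=
  (b p + a (comb phi x p)) * dot (gcomb g1 g2 x p) (gcomb g1 g2 w p).

Definition dstate_int (x z w : 'rV[R]_n) (p : T) : R :=
  dot ((b p + a (comb phi x p)) *: gcomb g1 g2 z p +
       (da (comb phi x p) * comb phi z p) *: gcomb g1 g2 x p) (gcomb g1 g2 w p).

Definition state_form x w : R := \int[mu]_(p in D) state_int x w p.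

Definition dstate_form x z w : R := \int[mu]_(p in D) dstate_int x z w p.

Definition state_fun (x : 'rV[R]_n) : 'rV[R]_n :=
  \row_j state_form x (delta_mx 0 j).

Definition state_jac (x : 'rV[R]_n) : 'M[R]_n :=
  \matrix_(i, j) dstate_form x (delta_mx 0 i) (delta_mx 0 j).

Lemma gcombD x z p : gcomb g1 g2 (x + z) p = gcomb g1 g2 x p + gcomb g1 g2 z p.
Proof. by rewrite /gcomb !combD. Qed.

Lemma gcombZ c x p : gcomb g1 g2 (c *: x) p = c *: gcomb g1 g2 x p.
Proof. by rewrite /gcomb !combZ. Qed.

Let K := n%:R * B.

Let K0 : 0 <= K. Proof. by rewrite mulr_ge0. Qed.

Lemma comb_phi_le x p : D p -> `|comb phi x p| <= K * `|x|.
Proof. by move=> Dp; apply: comb_le => i; exact: phi_le. Qed.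

Lemma gcomb_le x p : D p -> `|gcomb g1 g2 x p| <= K * `|x|.
Proof.
move=> Dp; rewrite [leLHS]/Num.norm /= ge_max.
by rewrite !comb_le// => i; [exact: g2_le|exact: g1_le].
Qed.

Lemma measurable_comb (v : 'I_n -> T -> R) x :
  (forall i, measurable_fun D (v i)) -> measurable_fun D (comb v x).
Proof.
move=> mv; apply: measurable_sum => i; apply: measurable_funM => //.
Qed.

Lemma measurable_state_int x w : measurable_fun D (state_int x w).
Proof.
have mx := measurable_comb x mphi.
apply: measurable_funM.
  by apply: measurable_funD => //; exact: measurableT_comp.
by apply: measurable_funD; apply: measurable_funM; exact: measurable_comb.
Qed.

Lemma measurable_dstate_int x z w : measurable_fun D (dstate_int x z w).
Proof.
have mx := measurable_comb x mphi.
have mz := measurable_comb z mphi.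
have ? : measurable_fun D (fun p => b p + a (comb phi x p)).
  by apply: measurable_funD => //; exact: measurableT_comp.
have ? : measurable_fun D (fun p => da (comb phi x p) * comb phi z p).
  by apply: measurable_funM => //; exact: measurableT_comp.
by apply: measurable_funD; apply: measurable_funM; try exact: measurable_comb;
  apply: measurable_funD; apply: measurable_funM => //; exact: measurable_comb.
Qed.

(** The combinations take values in a bounded interval when the coefficients are
    bounded, and [a] and [da] are bounded there. *)
Lemma coef_bound (M : R) : exists2 C : R, 0 <= C & forall x p, `|x| <= M -> D p ->
  `|b p + a (comb phi x p)| <= C /\ `|da (comb phi x p)| <= C.
Proof.
have [M0|M0] := ltP M 0.
  by exists 0 => // x p /le_lt_trans /(_ M0); rewrite normr_lt0.
have KM0 : 0 <= K * M by rewrite mulr_ge0.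
have [L L0 Llip] := a_lip (K * M).
exists (B + (`|a 0| + L * (K * M)) + L).
  by rewrite !addr_ge0// mulr_ge0.
move=> x p xM Dp.
have Yle : `|comb phi x p| <= K * M.
  by rewrite (le_trans (comb_phi_le _ _))// ler_wpM2l.
have [|a_le da_le] := Llip (comb phi x p) 0 Yle; first by rewrite normr0.
have ? : L * `|comb phi x p| <= L * (K * M) by rewrite ler_wpM2l.
have ? : 0 <= L * (K * M) by rewrite mulr_ge0.
rewrite subr0 in a_le; split; last first.
  by rewrite (le_trans da_le)// lerDr addr_ge0// addr_ge0.
have := ler_normD (b p) (a (comb phi x p)).
have := ler_normD (a (comb phi x p) - a 0) (a 0).
by rewrite subrK; have := b_le Dp; lra.
Qed.

Lemma state_int_bounded x w : exists C : R, forall p, D p -> `|state_int x w p| <= C.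
Proof.
have [C C0 Cle] := coef_bound `|x|.
exists (C * (2 * (K * `|x|) * (K * `|w|))) => p Dp.
rewrite normrM ler_pM//; first by have [] := Cle x p (lexx _) Dp.
rewrite (le_trans (dot_le _ _))//.
by rewrite ler_pM ?mulr_ge0// ?ler_pM2l//; exact: gcomb_le.
Qed.

Lemma dstate_int_bounded (M : R) : exists C : R, forall x z w p,
  `|x| <= M -> `|z| <= M -> `|w| <= M -> D p -> `|dstate_int x z w p| <= C.
Proof.
have [C C0 Cle] := coef_bound M.
exists (2 * (C * (K * M) + C * (K * M) * (K * M)) * (K * M)) => x z w p xM zM wM Dp.
have [Cb Cda] := Cle x p xM Dp.
have le_KM (N y : R) : N <= K * y -> y <= M -> N <= K * M.
  by move=> Ny yM; rewrite (le_trans Ny)// ler_wpM2l.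
have ? := le_KM _ _ (gcomb_le x Dp) xM.
have ? := le_KM _ _ (gcomb_le z Dp) zM.
have ? := le_KM _ _ (gcomb_le w Dp) wM.
have ? := le_KM _ _ (comb_phi_le z Dp) zM.
rewrite (le_trans (dot_le _ _))//; apply: ler_pM => //.
rewrite ler_pM2l// (le_trans (ler_normD _ _))// lerD// normrZ ?normrM.
  exact: ler_pM.
by apply: ler_pM => //; exact: ler_pM.
Qed.

Lemma integrable_state_int x w : mu.-integrable D (EFin \o state_int x w).
Proof.
have [C Cle] := state_int_bounded x w.
exact: bounded_integrable (measurable_state_int x w) Cle.
Qed.

Lemma integrable_dstate_int x z w : mu.-integrable D (EFin \o dstate_int x z w).
Proof.
have [C Cle] := dstate_int_bounded (`|x| + `|z| + `|w|).
apply: (@bounded_integrable _ _ _ _ _ mD Dfin _ C).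
  exact: measurable_dstate_int.
by move=> p Dp; apply: Cle => //; have := normr_ge0 x; have := normr_ge0 z;
  have := normr_ge0 w; lra.
Qed.

Lemma dstate_intD1 x z z' w p :
  dstate_int x (z + z') w p = dstate_int x z w p + dstate_int x z' w p.
Proof. by rewrite /dstate_int combD gcombD !(dotDl, dotZl); ring. Qed.

Lemma dstate_intZ1 x c z w p : dstate_int x (c *: z) w p = c * dstate_int x z w p.
Proof. by rewrite /dstate_int combZ gcombZ !(dotDl, dotZl); ring. Qed.

Lemma dstate_form_linear1 x w c z z' :
  dstate_form x (c *: z + z') w = c * dstate_form x z w + dstate_form x z' w.
Proof.
rewrite /dstate_form -RintegralZl//; last exact: integrable_dstate_int.
rewrite -RintegralD//; last 2 first.
- exact: (integrableZl mD c (integrable_dstate_int x z w)).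
- exact: integrable_dstate_int.
by apply: eq_Rintegral => p _; rewrite dstate_intD1 dstate_intZ1.
Qed.

Lemma dstate_form_linear2 x z c w w' :
  dstate_form x z (c *: w + w') = c * dstate_form x z w + dstate_form x z w'.
Proof.
rewrite /dstate_form -RintegralZl//; last exact: integrable_dstate_int.
rewrite -RintegralD//; last 2 first.
- exact: (integrableZl mD c (integrable_dstate_int x z w)).
- exact: integrable_dstate_int.
apply: eq_Rintegral => p _.
by rewrite /dstate_int gcombD gcombZ dotDr dotZr.
Qed.

Lemma state_form_linear2 x c w w' :
  state_form x (c *: w + w') = c * state_form x w + state_form x w'.
Proof.
rewrite /state_form -RintegralZl//; last exact: integrable_state_int.
rewrite -RintegralD//; last 2 first.
- exact: (integrableZl mD c (integrable_state_int x w)).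
- exact: integrable_state_int.
apply: eq_Rintegral => p _.
by rewrite /state_int gcombD gcombZ dotDr dotZr; ring.
Qed.

Lemma mul_state_jac x z j :
  (z *m state_jac x) 0 j = dstate_form x z (delta_mx 0 j).
Proof.
rewrite (linear_row_sum z (dstate_form_linear1 x (delta_mx 0 j))) mxE.
by apply: eq_bigr => i _; rewrite mxE.
Qed.

(** The remainder of the linearization.  By [state_remE] it is the sum of a term
    quadratic in [z] and of the remainder of [a], multiplied by grad y. *)
Definition state_rem x z w p : R :=
  state_int (x + z) w p - state_int x w p - dstate_int x z w p.

Lemma state_remE x z w p : state_rem x z w p =
  (a (comb phi x p + comb phi z p) - a (comb phi x p)) *
     dot (gcomb g1 g2 z p) (gcomb g1 g2 w p) +
  (a (comb phi x p + comb phi z p) - a (comb phi x p) -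
     da (comb phi x p) * comb phi z p) * dot (gcomb g1 g2 x p) (gcomb g1 g2 w p).
Proof.
by rewrite /state_rem /state_int /dstate_int combD gcombD !(dotDl, dotZl); ring.
Qed.

Lemma dot_gcomb_le x w p : D p ->
  `|dot (gcomb g1 g2 x p) (gcomb g1 g2 w p)| <= 2 * K ^+ 2 * `|x| * `|w|.
Proof.
move=> Dp; rewrite (le_trans (dot_le _ _))//.
rewrite [leRHS](_ : _ = 2 * (K * `|x|) * (K * `|w|)); last by ring.
by rewrite ler_pM ?mulr_ge0// ?ler_pM2l//; exact: gcomb_le.
Qed.

Lemma state_rem_le x w : exists2 L : R, 0 <= L & forall z p, `|z| <= 1 -> D p ->
  let t := comb phi x p in let s := comb phi z p in
  [/\ `|a (t + s) - a t| <= L * `|z|, `|da t * s| <= L * `|z| &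
  `|state_rem x z w p| <= L * `|z| ^+ 2 +
     `|a (t + s) - a t - da t * s| * `|dot (gcomb g1 g2 x p) (gcomb g1 g2 w p)|].
Proof.
have [L L0 Llip] := a_lip (K * (`|x| + 1)).
have LK0 : 0 <= L * K by rewrite mulr_ge0.
have C0 : 0 <= L * K * (2 * K ^+ 2 * `|w|) by rewrite !mulr_ge0.
exists (L * K * (2 * K ^+ 2 * `|w|) + L * K); first exact: addr_ge0.
move=> z p z1 Dp t s.
have sle : `|s| <= K * `|z| := comb_phi_le z Dp.
have tle : `|t| <= K * (`|x| + 1).
  by rewrite (le_trans (comb_phi_le x Dp))// ler_wpM2l// lerDl.
have tsle : `|t + s| <= K * (`|x| + 1).
  rewrite /t /s -combD (le_trans (comb_phi_le _ Dp))// ler_wpM2l//.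
  by rewrite (le_trans (ler_normD _ _))// lerD2l.
have z0 := normr_ge0 z.
have Lsle : L * `|s| <= L * K * `|z| by rewrite -mulrA ler_wpM2l.
have le1 : `|a (t + s) - a t| <= L * K * `|z|.
  have [ale _] := Llip _ _ tsle tle.
  by rewrite (le_trans ale)// addrAC subrr add0r.
have le2 : `|da t * s| <= L * K * `|z|.
  have [_ dale] := Llip _ _ tle tle.
  by rewrite normrM (le_trans _ Lsle)// ler_wpM2r.
have CLz : 0 <= L * K * (2 * K ^+ 2 * `|w|) * `|z| by rewrite mulr_ge0.
split; [by lra|by lra|].
rewrite state_remE (le_trans (ler_normD _ _))// !normrM lerD2r.
rewrite (le_trans (ler_pM _ _ le1 (dot_gcomb_le z w Dp)))//.
rewrite [leLHS](_ : _ = L * K * (2 * K ^+ 2 * `|w|) * `|z| ^+ 2); last by ring.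
by rewrite ler_wpM2r ?exprn_ge0// lerDl.
Qed.

(** At a point where y differs from [tbar] the remainder of [a] is small; at a
    point where grad y vanishes it is multiplied by zero. *)
Lemma state_rem_near x w p : D p -> comb phi x p != tbar \/ gcomb g1 g2 x p = 0 ->
  forall e : R, 0 < e ->
  \forall z \near (0 : 'rV[R]_n), `|state_rem x z w p| <= e * `|z|.
Proof.
move=> Dp kink e e0; have [L L0 Lle] := state_rem_le x w.
have near1 : \forall z \near (0 : 'rV[R]_n), `|z| <= 1.
  by apply: nbhs0_le.
have nearL : \forall z \near (0 : 'rV[R]_n), `|z| <= e / 2 / (L + 1).
  by apply: nbhs0_le; rewrite !divr_gt0// ltr_wpDl.
set c := `|dot (gcomb g1 g2 x p) (gcomb g1 g2 w p)|.
have c0 : 0 <= c by exact: normr_ge0.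
have near_a : \forall z \near (0 : 'rV[R]_n),
    `|a (comb phi x p + comb phi z p) - a (comb phi x p) -
       da (comb phi x p) * comb phi z p| * c <= e / 2 * `|z|.
  case: kink => [t_neq|Gx0]; last first.
    by near=> z; rewrite /c Gx0 dot0l normr0 mulr0 mulr_ge0// divr_ge0// ltW.
  have Kc0 : 0 < K * c + 1 by rewrite ltr_wpDl// mulr_ge0.
  have e'0 : 0 < e / 2 / (K * c + 1) by rewrite !divr_gt0.
  have cvg0 : comb phi z p @[z --> (0 : 'rV[R]_n)] --> (0 : R).
    apply/(@cvgr0Pnorm_le _ _ _ (nbhs (0 : 'rV[R]_n))) => r r0.
    have rK0 : 0 < r / (K + 1) by rewrite divr_gt0// ltr_wpDl.
    have := nbhs0_le rK0 : \forall z \near (0 : 'rV[R]_n), `|z| <= r / (K + 1).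
    apply: filterS => z; rewrite ler_pdivlMr ?ltr_wpDl// => zr.
    rewrite (le_trans (comb_phi_le z Dp))// (le_trans _ zr)//.
    by have := normr_ge0 z; lra.
  have : \forall z \near (0 : 'rV[R]_n),
      `|a (comb phi x p + comb phi z p) - a (comb phi x p) -
        da (comb phi x p) * comb phi z p|
      <= e / 2 / (K * c + 1) * `|comb phi z p| := cvg0 _ (a_diff t_neq e'0).
  apply: filterS => z zle.
  rewrite (le_trans (ler_wpM2r _ zle))//.
  rewrite -[leLHS]mulrA -[leLHS]mulrA ler_wpM2l ?divr_ge0 ?(ltW e0)//.
  rewrite ler_pdivrMl//.
  have := ler_wpM2r c0 (comb_phi_le z Dp).
  by have := normr_ge0 z; lra.
apply: filterS3 near1 nearL near_a => z z1 zL za.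
have [_ _ /le_trans] := Lle z p z1 Dp.
apply; rewrite [e in leRHS](splitr e) mulrDl lerD//.
rewrite expr2 mulrA ler_wpM2r//.
move: zL; rewrite ler_pdivlMr ?ltr_wpDl//.
by have := normr_ge0 z; lra.
Unshelve. all: by end_near. Qed.

Lemma measurable_state_rem x z w : measurable_fun D (state_rem x z w).
Proof.
apply: measurable_funB; last exact: measurable_dstate_int.
by apply: measurable_funB; exact: measurable_state_int.
Qed.

Lemma integrable_state_rem x z w : mu.-integrable D (EFin \o state_rem x z w).
Proof.
exact: (integrableB mD (integrableB mD (integrable_state_int _ _)
  (integrable_state_int _ _)) (integrable_dstate_int _ _ _)).
Qed.

Lemma integral_state_rem x z w :
  \int[mu]_(p in D) state_rem x z w p =
  state_form (x + z) w - state_form x w - dstate_form x z w.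
Proof.
rewrite /state_rem /state_form /dstate_form RintegralB//; last 2 first.
- exact: (integrableB mD (integrable_state_int _ _) (integrable_state_int _ _)).
- exact: integrable_dstate_int.
by rewrite RintegralB//; exact: integrable_state_int.
Qed.

(** The quotients of the remainder by the norm of [z] are bounded and tend to
    zero almost everywhere. *)
Lemma state_form_diff x w (e : R) : 0 < e -> \forall z \near (0 : 'rV[R]_n),
  `|state_form (x + z) w - state_form x w - dstate_form x z w| <= e * `|z|.
Proof.
move=> e0; have [L L0 Lle] := state_rem_le x w.
(* At [z = 0] the inverse of the norm is zero, so that [q 0 = 0]. *)
pose q (z : 'rV[R]_n) p := `|z|^-1 * state_rem x z w p.
have intq z : \int[mu]_(p in D) q z p =
    `|z|^-1 * \int[mu]_(p in D) state_rem x z w p.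
  by rewrite RintegralZl//; exact: integrable_state_rem.
have q0 p : q 0 p = 0 by rewrite /q normr0 invr0 mul0r.
have q_cvg : \int[mu]_(p in D) q z p @[z --> (0 : 'rV[R]_n)] -->
    \int[mu]_(p in D) q 0 p.
  apply: (@bounded_continuous_Rintegral _ _ _ _ _ mD Dfin _ _ _
    (L + 2 * L * (2 * K ^+ 2 * `|x| * `|w|))) => [z _|z p z1 Dp|].
  - by apply: measurable_funM => //; exact: measurable_state_rem.
  - rewrite subr0 in z1; rewrite normrM normfV normr_id.
    have [->|z_neq0] := eqVneq z 0.
      by rewrite normr0 invr0 mul0r addr_ge0// !mulr_ge0.
    rewrite ler_pdivrMl ?normr_gt0//.
    have [le1 le2 /le_trans] := Lle z p (ltW z1) Dp; apply.
    rewrite mulrDr lerD//.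
      by rewrite expr2 mulrCA ler_wpM2l// ler_piMr// ltW.
    rewrite [leRHS]mulrA ler_pM//; last exact: dot_gcomb_le.
    rewrite (le_trans (ler_normB _ _))//; lra.
  - apply: filterS (off_kink x) => p /[swap] Dp /(_ Dp) kink.
    rewrite q0; apply/(@cvgr0Pnorm_le _ _ _ (nbhs (0 : 'rV[R]_n))) => r r0.
    apply: filterS (state_rem_near w Dp kink r0) => z zle.
    rewrite normrM normfV normr_id; have [->|z_neq0] := eqVneq z 0.
      by rewrite normr0 invr0 mul0r ltW.
    by rewrite ler_pdivrMl ?normr_gt0// mulrC.
have int0 : \int[mu]_(p in D) q 0 p = 0 by rewrite intq normr0 invr0 mul0r.
rewrite int0 in q_cvg.
have : \forall z \near (0 : 'rV[R]_n), `|\int[mu]_(p in D) q z p| <= e.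
  exact: (@cvgr0Pnorm_le _ _ _ (nbhs (0 : 'rV[R]_n)) _ _).1 q_cvg _ e0.
apply: filterS => z; rewrite -integral_state_rem.
have [->|z_neq0] := eqVneq z 0; last first.
  by rewrite intq normrM normfV normr_id ler_pdivrMl ?normr_gt0// mulrC.
move=> _; rewrite integral_state_rem addr0 subrr sub0r normrN normr0 mulr0.
have := dstate_form_linear1 x w 1 0 0; rewrite scale1r addr0 mul1r => lin.
by rewrite (_ : dstate_form x 0 w = 0) ?normr0//; lra.
Qed.

Lemma comb_continuous (v : 'I_n -> T -> R) p : continuous (comb v ^~ p).
Proof.
apply: continuous_big => [|i _ x]; first exact: add_continuous.
have : x 0 i @[x --> x] --> x 0 i by exact: coord_continuous.
exact: cvgMr_tmp.
Qed.

Lemma dot_gcomb_continuous w p : continuous (fun x => dot (gcomb g1 g2 x p) (gcomb g1 g2 w p)).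
Proof.
move=> x; apply: (@cvgD _ _ _ (nbhs x)); apply: (@cvgMr_tmp _ _ (nbhs x));
  exact: comb_continuous.
Qed.

Lemma dstate_intE x z w p : dstate_int x z w p =
  (b p + a (comb phi x p)) * dot (gcomb g1 g2 z p) (gcomb g1 g2 w p) +
  da (comb phi x p) * comb phi z p * dot (gcomb g1 g2 x p) (gcomb g1 g2 w p).
Proof. by rewrite /dstate_int dotDl !dotZl. Qed.

(** The only discontinuous factor is [da], at points where y = [tbar]; almost
    everywhere there grad y vanishes, and it multiplies [da]. *)
Lemma dstate_form_continuous z w : continuous (fun x => dstate_form x z w).
Proof.
move=> x0; rewrite /continuous_at /dstate_form.
have [C Cle] := dstate_int_bounded (`|x0| + 1 + `|z| + `|w|).
apply: (@bounded_continuous_Rintegral _ _ _ _ _ mD Dfin _ _ _ C) => [x _|x p x1 Dp|].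
- exact: measurable_dstate_int.
- apply: Cle => //; have := normr_ge0 z; have := normr_ge0 w; have := normr_ge0 x0.
  + have := ler_normD x0 (x - x0); rewrite addrC subrK; lra.
  + lra.
  + lra.
apply: filterS (off_kink x0) => p /[swap] Dp /(_ Dp) kink.
under eq_fun do rewrite dstate_intE.
rewrite dstate_intE; apply: (@cvgD _ _ _ (nbhs x0)).
  apply: (@cvgMr_tmp _ _ (nbhs x0)); apply: (@cvgD _ _ _ (nbhs x0)).
    exact: cvg_cst.
  by apply: continuous_comp; [exact: comb_continuous|exact: a_continuous].
case: kink => [t_neq|Gx0].
  apply: (@cvgM _ _ (nbhs x0)); last exact: dot_gcomb_continuous.
  by apply: (@cvgMr_tmp _ _ (nbhs x0)); apply: continuous_comp;
    [exact: comb_continuous|exact: da_cont].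
rewrite Gx0 dot0l mulr0.
have [c c0 cle] := coef_bound (`|x0| + 1).
have dot0 : c * `|comb phi z p| * dot (gcomb g1 g2 x p) (gcomb g1 g2 w p) @[x --> x0] --> 0.
  rewrite [X in _ --> X](_ : 0 =
      c * `|comb phi z p| * dot (gcomb g1 g2 x0 p) (gcomb g1 g2 w p)).
    by apply: (@cvgMl_tmp _ _ (nbhs x0)); exact: dot_gcomb_continuous.
  by rewrite Gx0 dot0l mulr0.
apply/(@cvgr0Pnorm_le _ _ _ (nbhs x0)) => r r0.
have near_dot : \forall x \near x0,
    `|c * `|comb phi z p| * dot (gcomb g1 g2 x p) (gcomb g1 g2 w p)| <= r.
  exact: (@cvgr0Pnorm_le _ _ _ (nbhs x0) _ _).1 dot0 _ r0.
have near1 : \forall x \near x0, `|x0 - x| <= 1.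
  exact: (@cvgr_dist_le _ _ _ (nbhs x0) _ id x0 _ _ ltr01).
apply: filterS2 near_dot near1 => x xr x1; rewrite (le_trans _ xr)//.
rewrite !normrM normr_id (ger0_norm c0) ler_wpM2r// ler_wpM2r//.
have [] := cle x p _ Dp => //.
by have := ler_normB x0 (x0 - x); rewrite opprB addrC subrK; lra.
Qed.

Lemma state_fun_diff x (e : R) : 0 < e -> \forall z \near (0 : 'rV[R]_n),
  `|state_fun (x + z) - state_fun x - z *m state_jac x| <= e * `|z|.
Proof.
move=> e0; have near_j : \forall z \near (0 : 'rV[R]_n), forall j : 'I_n,
    `|state_form (x + z) (delta_mx 0 j) - state_form x (delta_mx 0 j) -
      dstate_form x z (delta_mx 0 j)| <= e * `|z|.
  by apply: (@filter_forall _ _ _ (nbhs (0 : 'rV[R]_n))) => j; exact: state_form_diff.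
apply: filterS near_j => z zle; apply: mx_norm_le => [|i j].
  by rewrite mulr_ge0// ltW.
have := mul_state_jac x z j; rewrite (ord1 i) !mxE => ->.
exact: zle.
Qed.

Lemma state_jac_near x0 (e : R) : 0 < e ->
  \forall x \near x0, `|state_jac x - state_jac x0| <= e.
Proof.
move=> e0; have near_ij i j : \forall x \near x0, `|state_jac x i j - state_jac x0 i j| <= e.
  have := @dstate_form_continuous (delta_mx 0 i) (delta_mx 0 j) x0.
  move=> /(@cvgr_dist_le _ _ _ (nbhs x0)) /(_ _ e0).
  by apply: filterS => x; rewrite !mxE distrC.
have near_all : \forall x \near x0, forall i j,
    `|state_jac x i j - state_jac x0 i j| <= e.
  apply: (@filter_forall _ _ _ (nbhs x0)) => i.
  by apply: (@filter_forall _ _ _ (nbhs x0)) => j; exact: near_ij.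
apply: filterS near_all => x xle; apply: mx_norm_le => [|i j]; first exact: ltW.
by have := xle i j; rewrite !mxE.
Qed.

End QuasilinearForm.

(** * Inverting a differentiable map on a compact set *)

Section InverseOnCompact.
Context (R : realType) (n : nat).

Lemma ler_mulmx_norm (z : 'rV[R]_n) (M : 'M[R]_n) :
  `|z *m M| <= n%:R * `|M| * `|z|.
Proof.
apply: mx_norm_le => [|i j]; first by rewrite !mulr_ge0.
rewrite mxE (le_trans (ler_norm_sum _ _ _))//.
rewrite (@le_trans _ _ (\sum_(k < n) `|z| * `|M|))//.
  by apply: ler_sum => k _; rewrite normrM ler_pM// ler_coord.
by rewrite sumr_const card_ord -mulr_natl; lra.
Qed.

Variables (F : 'rV[R]_n -> 'rV[R]_n) (J : 'rV[R]_n -> 'M[R]_n).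
Variable K : set 'rV[R]_n.
Hypothesis F_diff : forall x (e : R), 0 < e -> \forall z \near (0 : 'rV[R]_n),
  `|F (x + z) - F x - z *m J x| <= e * `|z|.
Hypothesis J_near : forall x (e : R), 0 < e ->
  \forall y \near x, `|J y - J x| <= e.

Lemma diff_continuous : continuous F.
Proof.
move=> x; apply/(@cvgrPdist_le _ _ _ (nbhs x)) => e e0.
set c := n%:R * `|J x| + 1.
have c0 : 0 < c by rewrite ltr_wpDl// mulr_ge0.
have ec0 : 0 < e / c by rewrite divr_gt0.
have /nbhs_normP[r /= r0 rle] := F_diff x ltr01.
have m0 : 0 < Num.min r (e / c) by rewrite lt_min r0.
suff : \forall y \near x, `|F x - F y| <= e by [].
apply/nbhs_normP; exists (Num.min r (e / c)) => //= y.
rewrite /ball_/= distrC lt_min => /andP[yr ye].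
have := rle (y - x); rewrite /ball_/= sub0r normrN => /(_ yr).
rewrite [x + _]addrC subrK mul1r => Fle; rewrite distrC.
have := ler_normD (F y - F x - (y - x) *m J x) ((y - x) *m J x).
rewrite subrK => /le_trans; apply.
have cle : `|y - x| * c <= e by rewrite -ler_pdivlMr// ltW.
rewrite (le_trans _ cle)// /c mulrDr mulr1 [leRHS]addrC lerD//.
by rewrite [leRHS]mulrC; exact: ler_mulmx_norm.
Qed.

Hypotheses (cK : compact K) (x0 : 'rV[R]_n)
  (J_unit : J x0 \in unitmx) (F_inj : forall x, K x -> F x = F x0 -> x = x0).

(** The image under [F] of the part of [K] away from [x0] is compact and does not
    contain [F x0], hence avoids a neighbourhood of it. *)
Lemma inverse_continuous (e : R) : 0 < e -> exists2 r : R, 0 < r &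
  forall x, K x -> `|F x - F x0| < r -> `|x - x0| < e.
Proof.
move=> e0; pose far := K `&` ~` ball x0 e.
have cfar : compact far.
  by apply: compact_closedI => //; apply: open_closedC; exact: ball_open.
have cF : compact (F @` far).
  apply: continuous_compact cfar.
  by apply: continuous_subspaceT; exact: diff_continuous.
have oF : open (~` (F @` far)).
  by apply: closed_openC; apply: compact_closed => //; exact: norm_hausdorff.
have /nbhs_normP[r /= r0 rle] : nbhs (F x0) (~` (F @` far)).
  apply: open_nbhs_nbhs; split => // -[x [Kx xfar] Fx].
  by apply: xfar; rewrite (F_inj Kx Fx); exact: ballxx.
exists r => // x Kx xr; rewrite ltNge; apply/negP => ex.
apply: (rle (F x)); first by rewrite /ball_/= distrC.
exists x => //; split => //.
by rewrite -ball_normE /ball_/= distrC => /lt_le_trans/(_ ex); rewrite ltxx.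
Qed.

Let c : R := n%:R * `|invmx (J x0)| + 1.

Let c_gt0 : 0 < c. Proof. by rewrite ltr_wpDl// mulr_ge0. Qed.

Let invJ_le (w : 'rV[R]_n) : `|w *m invmx (J x0)| <= c * `|w|.
Proof.
rewrite (le_trans (ler_mulmx_norm _ _))// /c mulrDl mul1r.
by rewrite lerDl.
Qed.

(** Multiplying the expansion of [F] at [x0] by the inverse Jacobian expresses
    the error through the remainder, which is small compared to [x - x0].  The
    same identity bounds [x - x0] by a multiple of [F x - F x0]. *)
Lemma inverse_diff (e : R) : 0 < e -> exists2 r : R, 0 < r &
  forall x, K x -> `|F x - F x0| < r ->
  `|x - x0 - (F x - F x0) *m invmx (J x0)| <= e * `|F x - F x0|.
Proof.
move=> e0.
(* The first bound allows to absorb the remainder when estimating [x - x0], the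
   second one yields [e]. *)
pose t := Num.min (2^-1 / c) (e / (2 * c ^+ 2)).
have t0 : 0 < t by rewrite lt_min !divr_gt0// mulr_gt0// exprn_gt0.
have /nbhs_normP[s /= s0 sle] := F_diff x0 t0.
have [r r0 rle] := inverse_continuous s0.
exists r => // x Kx xr.
have := sle (x - x0); rewrite /ball_/= sub0r normrN => /(_ (rle x Kx xr)).
rewrite [x0 + _]addrC subrK => rem_le.
set w := F x - F x0 in rem_le *; set z := x - x0 in rem_le *.
clearbody w z.
have zE : z - w *m invmx (J x0) = - ((w - z *m J x0) *m invmx (J x0)).
  by rewrite mulmxBl mulmxK// opprB.
have le1 : `|z - w *m invmx (J x0)| <= c * (t * `|z|).
  rewrite zE normrN (le_trans (invJ_le _))// ler_pM2l//.
have ct : c * t <= 2^-1.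
  by rewrite -ler_pdivlMl// mulrC ge_min lexx.
have ct2 : 2 * c ^+ 2 * t <= e.
  by rewrite -ler_pdivlMl ?mulr_gt0 ?exprn_gt0// mulrC ge_min lexx orbT.
have zle : `|z| <= 2 * c * `|w|.
  have := ler_normD (z - w *m invmx (J x0)) (w *m invmx (J x0)).
  have := ler_wpM2r (normr_ge0 z) ct.
  by rewrite subrK; have := invJ_le w; lra.
rewrite (le_trans le1)//.
have := ler_wpM2r (normr_ge0 w) ct2.
have ct0 : 0 <= c * t by rewrite mulr_ge0// ltW.
have := ler_wpM2l ct0 zle.
by lra.
Qed.

(** The difference of the inverses of J x and J x0 is the product of the inverse
    of J x, of J x0 - J x and of the inverse of J x0; the first factor is bounded
    when J x is close to J x0. *)
Lemma inverse_jacobian_continuous (e : R) : 0 < e -> exists2 r : R, 0 < r &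
  forall x, K x -> J x \in unitmx -> `|F x - F x0| < r ->
  forall w : 'rV[R]_n, `|w *m invmx (J x) - w *m invmx (J x0)| <= e * `|w|.
Proof.
move=> e0.
pose N : R := n%:R + 1.
have N0 : 0 < N by rewrite ltr_wpDl.
pose t := Num.min (2^-1 / (c * N)) (e / (2 * c ^+ 2 * N)).
have t0 : 0 < t by rewrite lt_min !divr_gt0// !mulr_gt0// exprn_gt0.
have /nbhs_normP[s /= s0 sle] := J_near x0 t0.
have [r r0 rle] := inverse_continuous s0.
exists r => // x Kx Jx xr w.
have Jle : `|J x - J x0| <= t.
  by apply: sle; rewrite /ball_/= distrC; exact: rle.
set z := w *m invmx (J x).
have zE : z - w *m invmx (J x0) = - (z *m (J x - J x0) *m invmx (J x0)).
  by rewrite mulmxBr mulmxBl /z mulmxKV// mulmxK// opprB.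
have le1 : `|z - w *m invmx (J x0)| <= c * N * t * `|z|.
  rewrite zE normrN (le_trans (invJ_le _))// -!mulrA ler_pM2l//.
  rewrite (le_trans (ler_mulmx_norm _ _))// mulrA ler_wpM2r//.
  by rewrite ler_pM// lerDl.
have ct : c * N * t <= 2^-1.
  by rewrite -ler_pdivlMl ?mulr_gt0// mulrC ge_min lexx.
have ct2 : 2 * c ^+ 2 * N * t <= e.
  by rewrite -ler_pdivlMl ?mulr_gt0 ?exprn_gt0// mulrC ge_min lexx orbT.
have zle : `|z| <= 2 * c * `|w|.
  have := ler_normD (z - w *m invmx (J x0)) (w *m invmx (J x0)).
  have := ler_wpM2r (normr_ge0 z) ct.
  by rewrite subrK; have := invJ_le w; lra.
rewrite (le_trans le1)//.
have := ler_wpM2r (normr_ge0 w) ct2.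
have ct0 : 0 <= c * N * t by rewrite !mulr_ge0// ltW.
have := ler_wpM2l ct0 zle.
by lra.
Qed.

End InverseOnCompact.

(** * Lebesgue norms on a set of finite measure *)

Section RestrictedLnorm.
Context d (T : measurableType d) (R : realType) (mu : {measure set T -> \bar R}).
Variables (D : set T) (mD : measurable D).
Implicit Types (f g h : T -> R) (p : R).

(** The norm of [Lpnorm], on an arbitrary measure space. *)
Definition LnormD p f : \bar R := 'N[mu]_p%:E[EFin \o (f \_ D)]%E.

Lemma eq_LnormD p f g : (forall x, D x -> f x = g x) -> LnormD p f = LnormD p g.
Proof.
move=> fg; rewrite /LnormD; congr (Lnorm _ _ (_ \o _)); apply/funext => x.
by rewrite !patchE; case: ifPn => // /set_mem /fg.
Qed.

Lemma LnormD_ge0 p f : (0 <= LnormD p f)%E.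
Proof. exact: Lnorm_ge0. Qed.

Lemma LnormD_opp p f : LnormD p (\- f) = LnormD p f.
Proof.
rewrite /LnormD -oppe_Lnorm; congr (Lnorm _ _ _); apply/funext => x /=.
by rewrite !patchE; case: ifPn => _; rewrite /= ?opprK ?oppr0.
Qed.

Lemma LnormD_triangle p f g h : measurable_fun D f -> measurable_fun D g ->
  (forall x, D x -> h x = f x + g x) -> 1 <= p ->
  (LnormD p h <= LnormD p f + LnormD p g)%E.
Proof.
move=> mf mg hE p1; rewrite (eq_LnormD _ hE) /LnormD.
rewrite (_ : _ \_ D = f \_ D \+ g \_ D); last first.
  by apply/funext => x /=; rewrite !patchE; case: ifPn => //; rewrite addr0.
by apply: minkowski_EFin => //; exact: (measurable_restrictT _ mD).1.
Qed.

Lemma LnormD_bounded p f (C : R) : (mu D < +oo)%E -> 0 < p -> 0 <= C ->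
  measurable_fun D f -> (forall x, D x -> `|f x| <= C) ->
  (LnormD p f <= C%:E * mu D `^ p^-1)%E.
Proof.
move=> Dfin p0 C0 mf fC; rewrite /LnormD unlock.
have CE : C%:E = ((C%:E `^ p) `^ p^-1)%E.
  by rewrite -poweRrM divff ?gt_eqF// poweRe1.
rewrite [X in (X * _)%E]CE -poweRM; [|exact: poweR_ge0|by []].
have pV0 : 0 <= p^-1 by rewrite invr_ge0 ltW.
apply: (gt0_ler_poweR pV0).
- by rewrite in_itv/= leey andbT; apply: integral_ge0 => x _.
- by rewrite in_itv/= leey andbT; apply: mule_ge0 => //; rewrite lee_fin powR_ge0.
rewrite -integral_cst// [leRHS]integral_mkcond.
apply: ge0_le_integral => //.
- by move=> x _; exact: poweR_ge0.
- have mfD : measurable_fun setT (f \_ D) by exact: (measurable_restrictT _ mD).1.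
  apply: (measurableT_comp (measurable_poweR p)).
  by apply: measurableT_comp => //; exact/measurable_EFinP.
- by apply: (measurable_restrictT _ mD).1.
move=> x _ /=; rewrite [(f \_ D) x]patchE [leRHS]patchE.
case: ifPn => [/set_mem Dx|_]; last by rewrite normr0 powR0 ?gt_eqF.
by rewrite /= lee_fin ge0_ler_powR ?nnegrE// ?fC// ltW.
Qed.

Lemma LnormD_lty p f (C : R) : (mu D < +oo)%E -> 0 < p ->
  measurable_fun D f -> (forall x, D x -> `|f x| <= C) -> (LnormD p f < +oo)%E.
Proof.
move=> Dfin p0 mf fC.
apply: le_lt_trans (@LnormD_bounded p f `|C| Dfin p0 (normr_ge0 _) mf _) _.
  by move=> x /fC /le_trans; apply; exact: ler_norm.
by rewrite lte_mul_pinfty// poweR_lty.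
Qed.

(** On a set of finite measure a bounded function has a finite L^q norm, for the
    exponent [q] conjugate to [p]. *)
Lemma LnormD_hoelder p g (C : R) : (mu D < +oo)%E -> 1 < p ->
  measurable_fun D g -> (forall x, D x -> `|g x| <= C) ->
  exists2 m : R, 0 <= m & forall f, measurable_fun D f -> (LnormD p f < +oo)%E ->
    mu.-integrable D (EFin \o (f \* g)) /\
    (`|\int[mu]_(x in D) (f x * g x)|%:E <= m%:E * LnormD p f)%E.
Proof.
move=> Dfin p1 mg gC.
have p0 : 0 < p by rewrite (lt_trans _ p1).
pose q := (1 - p^-1)^-1.
have pV1 : p^-1 < 1 by rewrite invf_lt1.
have q0 : 0 < q by rewrite invr_gt0 subr_gt0.
have pq : p^-1 + q^-1 = 1 by rewrite /q invrK addrC subrK.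
have gfin : (LnormD q g < +oo)%E by exact: LnormD_lty gC.
have gE : LnormD q g = (fine (LnormD q g))%:E.
  by rewrite fineK// ge0_fin_numE// LnormD_ge0.
exists (fine (LnormD q g)); first by rewrite fine_ge0// LnormD_ge0.
move=> f mf ffin; rewrite -gE.
have fgE : (f \* g) \_ D = (f \_ D \* g \_ D).
  by apply/funext => x /=; rewrite !patchE; case: ifPn => //; rewrite mul0r.
have le1 : (\int[mu]_(x in D) `|(f x * g x)%:E| <= LnormD q g * LnormD p f)%E.
  rewrite integral_mkcond muleC.
  have hol := hoelder mu ((measurable_restrictT f mD).1 mf)
    ((measurable_restrictT g mD).1 mg) p0 q0 pq.
  rewrite Lnorm1 in hol; apply: le_trans hol.
  rewrite le_eqVlt; apply/orP; left; apply/eqP; apply: eq_integral => x _.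
  rewrite -fgE /= !patchE; case: ifPn => //=; by rewrite normr0.
have intfg : mu.-integrable D (EFin \o (f \* g)).
  apply/integrableP; split; first by apply/measurable_EFinP; exact: measurable_funM.
  by rewrite (le_lt_trans le1)// gE lte_mul_pinfty// lee_fin fine_ge0// LnormD_ge0.
split => //; apply: le_trans le1.
rewrite EFin_normr_Rintegral//.
by apply: le_abse_integral => //; apply/measurable_EFinP; exact: measurable_funM.
Qed.

Lemma Lnorm_restrict_null p f (W : set T) : measurable W -> D `<=` W ->
  mu (W `\` D) = 0%E -> 'N[mu]_p%:E[EFin \o (f \_ W)]%E = LnormD p f.
Proof.
move=> mW DW W0; apply: (@Lnorm_eq_off_null _ _ _ mu (W `\` D)) => //.
  exact: measurableD.
move=> x nWD; rewrite !patchE; case: ifPn => [/set_mem Wx|/negP nWx].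
  by case: ifPn => // /negP nDx; exfalso; apply: nWD; split => // /mem_set.
by case: ifPn => // /set_mem /DW /mem_set.
Qed.

End RestrictedLnorm.

Section ShapeNorm.
Context d (T : measurableType d) (R : realType) (mu : {measure set T -> \bar R}).
Variables (D : set T) (n : nat) (phi g1 g2 : 'I_n -> T -> R) (b : T -> R).
Variables (a da : R -> R) (tbar B p : R).
Hypothesis shapes : shape_family mu D phi g1 g2 b tbar B.
Hypothesis a_kinked : kinked tbar a da.
Hypothesis p1 : 1 < p.

Let mD : measurable D. Proof. by case: shapes => -[]. Qed.
Let Dfin : (mu D < +oo)%E. Proof. by case: shapes => -[]. Qed.
Let p0 : 0 < p. Proof. by rewrite (lt_trans _ p1). Qed.
Let mphi := shape_measurable shapes.
Let mg1 i := (shape_measurable_grad shapes i).1.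
Let mg2 i := (shape_measurable_grad shapes i).2.
Let g1_le i q (Dq : D q) := (shape_grad_le shapes i Dq).1.
Let g2_le i q (Dq : D q) := (shape_grad_le shapes i Dq).2.

(** The Sobolev norm W^{1,p} of the combination with coefficients [z]. *)
Definition shape_norm (z : 'rV[R]_n) : \bar R :=
  (LnormD mu D p (comb phi z) + LnormD mu D p (comb g1 z) +
   LnormD mu D p (comb g2 z))%E.

Lemma shape_norm_ge0 z : (0 <= shape_norm z)%E.
Proof. by rewrite !adde_ge0// LnormD_ge0. Qed.

Lemma shape_norm_le : exists2 C : R, 0 <= C &
  forall z : 'rV[R]_n, (shape_norm z <= (C * `|z|)%:E)%E.
Proof.
pose m := fine (mu D `^ p^-1)%E.
have mE : (mu D `^ p^-1 = m%:E)%E.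
  by rewrite /m fineK// ge0_fin_numE ?poweR_ge0// poweR_lty.
have m0 : 0 <= m by rewrite fine_ge0// poweR_ge0.
have B0 := shape_bound_ge0 shapes.
exists (3 * (n%:R * B * m)); first by rewrite !mulr_ge0.
move=> z.
have le_comb (g : 'I_n -> T -> R) : (forall i, measurable_fun D (g i)) ->
    (forall i q, D q -> `|g i q| <= B) ->
    (LnormD mu D p (comb g z) <= (n%:R * B * m * `|z|)%:E)%E.
  move=> mg gB; rewrite mulrAC EFinM -mE.
  apply: LnormD_bounded => //; first by rewrite !mulr_ge0.
    exact: measurable_comb.
  by move=> q Dq; apply: comb_le => i; exact: gB.
have le0 := le_comb _ mphi (shape_le shapes).
have le1 := le_comb _ mg1 g1_le.
have le2 := le_comb _ mg2 g2_le.
apply: (le_trans (leeD (leeD le0 le1) le2)).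
by rewrite -!EFinD lee_fin; lra.
Qed.

Lemma shape_norm_fin z : shape_norm z \is a fin_num.
Proof.
have [C _ Cle] := shape_norm_le.
rewrite ge0_fin_numE; first by rewrite (le_lt_trans (Cle z))// ltry.
exact: shape_norm_ge0.
Qed.

(** Hoelder's inequality applies to the density, a sum of three products of a
    combination with coefficients [z] and a bounded function independent of [z]. *)
Lemma dstate_form_bounded x w : exists2 m : R, 0 <= m & forall z : 'rV[R]_n,
  `|dstate_form mu D phi g1 g2 b a da x z w| <= m * fine (shape_norm z).
Proof.
have B0 := shape_bound_ge0 shapes.
have [C C0 C_le] := coef_bound shapes a_kinked `|x|.
have mcoef : measurable_fun D (fun q => b q + a (comb phi x q)).
  apply: measurable_funD; first exact: shape_measurable_coef shapes.
  apply: measurableT_comp; last by apply: measurable_comb; exact: shape_measurable shapes.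
  by apply: continuous_measurable_fun; exact: (a_continuous a_kinked).
pose k0 (q : T) := da (comb phi x q) * dot (gcomb g1 g2 x q) (gcomb g1 g2 w q).
pose k (g : 'I_n -> T -> R) (q : T) := (b q + a (comb phi x q)) * comb g w q.
have mk (g : 'I_n -> T -> R) : (forall i, measurable_fun D (g i)) ->
    measurable_fun D (k g).
  by move=> mg; apply: measurable_funM => //; exact: measurable_comb.
have mk0 : measurable_fun D k0.
  apply: measurable_funM.
    apply: measurableT_comp (kinked_measurable a_kinked) _.
    by apply: measurable_comb; exact: shape_measurable shapes.
  by apply: measurable_funD; apply: measurable_funM; exact: measurable_comb.
have k_le (g : 'I_n -> T -> R) : (forall i q, D q -> `|g i q| <= B) ->
    forall q, D q -> `|k g q| <= C * (n%:R * B * `|w|).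
  move=> gB q Dq; rewrite normrM ler_pM//; first by have [] := C_le x q (lexx _) Dq.
  by apply: comb_le => i; exact: gB.
have k0_le q : D q -> `|k0 q| <= C * (2 * (n%:R * B) ^+ 2 * `|x| * `|w|).
  move=> Dq; rewrite normrM ler_pM//; first by have [] := C_le x q (lexx _) Dq.
  exact: (dot_gcomb_le shapes).
have hol g Cg := @LnormD_hoelder _ T R mu D mD p g Cg Dfin p1.
have [m0 m00 hol0] := hol k0 _ mk0 k0_le.
have [m1 m10 hol1] := hol (k g1) _ (mk g1 mg1) (k_le g1 g1_le).
have [m2 m20 hol2] := hol (k g2) _ (mk g2 mg2) (k_le g2 g2_le).
exists (m0 + m1 + m2); first by rewrite !addr_ge0.
move=> z; have := shape_norm_fin z; rewrite /shape_norm fin_numD => /andP[].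
rewrite fin_numD => /andP[fin0 fin1] fin2.
have [||int0 le0] := hol0 (comb phi z); [exact: measurable_comb (shape_measurable shapes)|
  by rewrite ltey_eq fin0|].
have [||int1 le1] := hol1 (comb g1 z); [exact: measurable_comb mg1|by rewrite ltey_eq fin1|].
have [||int2 le2] := hol2 (comb g2 z); [exact: measurable_comb mg2|by rewrite ltey_eq fin2|].
have -> : dstate_form mu D phi g1 g2 b a da x z w =
    \int[mu]_(q in D) (comb phi z q * k0 q) +
    \int[mu]_(q in D) (comb g1 z q * k g1 q) +
    \int[mu]_(q in D) (comb g2 z q * k g2 q).
  have int01 := integrableD mD int0 int1.
  rewrite [RHS](_ : _ = \int[mu]_(q in D) (comb phi z q * k0 q +
      comb g1 z q * k g1 q + comb g2 z q * k g2 q)).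
    apply: eq_Rintegral => q _; rewrite dstate_intE /k0 /k.
    by rewrite [dot (gcomb _ _ z q) _]/dot /=; ring.
  symmetry; transitivity (\int[mu]_(q in D) (comb phi z q * k0 q +
      comb g1 z q * k g1 q) + \int[mu]_(q in D) (comb g2 z q * k g2 q)).
    by apply: RintegralD.
  by congr (_ + _); apply: RintegralD.
rewrite !fineD ?fin_numD ?fin0 ?fin1//.
have toR (X : R) (m : R) (N : \bar R) : N \is a fin_num ->
    (X%:E <= m%:E * N)%E -> X <= m * fine N.
  by move=> Nfin; rewrite -lee_fin EFinM fineK.
have le0R := toR _ _ _ fin0 le0.
have le1R := toR _ _ _ fin1 le1.
have le2R := toR _ _ _ fin2 le2.
set I0 := \int[mu]_(q in _) (comb phi z q * _) in le0R *.
set I1 := \int[mu]_(q in _) (comb g1 z q * _) in le1R *.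
set I2 := \int[mu]_(q in _) (comb g2 z q * _) in le2R *.
set N0 := fine _ in le0R *; set N1 := fine _ in le1R *; set N2 := fine _ in le2R *.
have N00 : 0 <= N0 by rewrite fine_ge0// Lnorm_ge0.
have N10 : 0 <= N1 by rewrite fine_ge0// Lnorm_ge0.
have N20 : 0 <= N2 by rewrite fine_ge0// Lnorm_ge0.
rewrite (le_trans (ler_normD _ _))// (le_trans (lerD (ler_normD _ _) (lexx _)))//.
rewrite (le_trans (lerD (lerD le0R le1R) le2R))// mulrDl mulrDl.
by rewrite lerD// ?lerD// ler_wpM2l// -?addrA ?lerDl ?addr_ge0//; lra.
Qed.

(** The norm bounds the coordinates: the entries of the product of [z] with the
    Jacobian are values of the linearized form, which the norm bounds, and the
    Jacobian is invertible. *)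
Lemma coord_le_shape_norm x :
  state_jac mu D phi g1 g2 b a da x \in unitmx ->
  exists2 C : R, 0 <= C & forall z : 'rV[R]_n, `|z| <= C * fine (shape_norm z).
Proof.
move=> Jx; set J := state_jac _ _ _ _ _ _ _ _ _ in Jx.
have /choice[m m_le] : forall j, exists m : R, 0 <= m /\ forall z : 'rV[R]_n,
    `|(z *m J) 0 j| <= m * fine (shape_norm z).
  move=> j; have [m m0 m_le] := dstate_form_bounded x (delta_mx 0 j).
  by exists m; split => // z; rewrite (mul_state_jac shapes a_kinked).
have m0 j : 0 <= m j by case: (m_le j).
have norm_ge0 z : 0 <= fine (shape_norm z) by rewrite fine_ge0// shape_norm_ge0.
exists (n%:R * `|invmx J| * \sum_j m j).
  by rewrite !mulr_ge0// sumr_ge0.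
move=> z; rewrite -[in leLHS](mulmxK Jx z) (le_trans (ler_mulmx_norm _ _))//.
rewrite -[leRHS]mulrA ler_wpM2l ?mulr_ge0//.
apply: mx_norm_le => [|i j]; first by rewrite mulr_ge0// sumr_ge0.
rewrite [i]ord1 (le_trans ((m_le j).2 z))// ler_wpM2r//.
by rewrite (bigD1 j)//= lerDl sumr_ge0.
Qed.

End ShapeNorm.

(** * Lebesgue measure of the plane *)

Section PlaneMeasure.
Context (R : realType).
Let plane := (measurableTypeR R * measurableTypeR R)%type.

(** An open set is a countable union of products of intervals with rational
    centres and radii. *)
Lemma open_measurable_plane (A : set (R * R)) :
  open A -> measurable (A : set plane).
Proof.
move=> oA.
pose box (p q r : rat) : set (R * R) :=
  ball (ratr p : R) (ratr r) `*` ball (ratr q : R) (ratr r).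
rewrite (_ : A = \bigcup_p \bigcup_q \bigcup_r
    (if `[< box p q r `<=` A >] then box p q r else set0)); last first.
  apply/seteqP; split => [x Ax|x [p _ [q _ [r _]]]]; last first.
    by case: ifPn => // /asboolP; apply.
  have /nbhs_ballP[e /= e0 eA] : nbhs x A by exact: open_nbhs_nbhs.
  have [r] : exists r : rat, ratr r \in `]0, (e / 2)[ by apply: rat_in_itvoo; rewrite divr_gt0.
  rewrite in_itv/= => /andP[r0 re].
  have near_rat (t : R) : exists q : rat, ball (ratr q : R) (ratr r) t.
    have [q] : exists q : rat, (ratr q : R) \in `](t - ratr r), (t + ratr r)[.
      by apply: rat_in_itvoo; lra.
    rewrite in_itv/= => tq; exists q; rewrite /ball /= ltr_distl; lra.
  have [p px] := near_rat x.1; have [q qx] := near_rat x.2.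
  exists p => //; exists q => //; exists r => //; case: ifPn => [_|/asboolP[]]; first by split.
  move=> y [/= py qy]; apply: eA; split; rewrite /ball/=.
    move: px py; rewrite /ball /= !ltr_distl; lra.
  move: qx qy; rewrite /ball /= !ltr_distl; lra.
apply: bigcupT_measurable_rat => p; apply: bigcupT_measurable_rat => q.
apply: bigcupT_measurable_rat => r; case: ifPn => // _.
by apply: measurableX; exact: measurable_ball.
Qed.

Lemma continuous_measurable_plane (D : set (R * R)) (f : R * R -> R) :
  open D -> (forall x, D x -> {for x, continuous f}) ->
  measurable_fun (D : set plane) (f : plane -> R).
Proof.
move=> oD cf mD; apply: (measurability _ (RGenOpens.measurableE R)) => //.
move=> _ [_ [a [b ->] <-]]; apply: open_measurable_plane.
rewrite openE => x [Dx fx]; apply: filterI; first exact: open_nbhs_nbhs.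
by apply: cf => //; apply: open_nbhs_nbhs; split => //; exact: interval_open.
Qed.

Lemma mu2X (A B : set (measurableTypeR R)) : measurable A -> measurable B ->
  mu2 (A `*` B) = (lebesgue_measure A * lebesgue_measure B)%E.
Proof. by move=> mA mB; rewrite /mu2 /= product_measure1E. Qed.

Definition line (n : R * R) (c : R) : set (R * R) := [set x | dot n x = c].

Lemma dot_continuous (n : R * R) : continuous (dot n).
Proof.
by move=> x; apply: cvgD; apply: cvgMl_tmp; [exact: cvg_fst|exact: cvg_snd].
Qed.

Lemma measurable_line n c : measurable (line n c : set plane).
Proof.
rewrite -[line n c]setCK; apply: measurableC; apply: open_measurable_plane.
rewrite (_ : ~` _ = dot n @^-1` [set t | t != c]).
  apply: open_comp; last exact: open_neq.
  by move=> x _; exact: dot_continuous.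
by apply/seteqP; split => x /= /eqP.
Qed.

(** A vertical line is a product with a point; every vertical section of another
    line is a point. *)
Lemma null_line n c : n != 0 -> mu2 (line n c) = 0%E.
Proof.
case: n => [n1 n2] n0; have [n20|n2_neq0] := eqVneq n2 0.
  have n1_neq0 : n1 != 0 by apply: contra_neq n0 => ->; rewrite n20.
  rewrite (_ : line _ _ = [set c / n1] `*` setT); last first.
    apply/seteqP; split => x; rewrite /line /dot /= n20 mul0r addr0.
      by move=> <-; split => //; rewrite mulrC mulKf.
    by move=> [-> _]; rewrite mulrC divfK.
  by rewrite mu2X// lebesgue_measure_set1 mul0e.
rewrite /mu2 /= /product_measure1 integral0_eq// => x _ /=.
rewrite (_ : xsection _ _ = [set (c - n1 * x) / n2]); first exact: lebesgue_measure_set1.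
apply/seteqP; split => y; rewrite /xsection /= inE /line /dot /=.
  by move=> <-; rewrite addrAC subrr add0r mulrC mulKf.
by move=> ->; rewrite [n2 * _]mulrC divfK// addrC subrK.
Qed.

Lemma bounded_mu2 (A : set (R * R)) : bounded_set A ->
  measurable (A : set plane) -> (mu2 A < +oo)%E.
Proof.
move=> [M [_ AM]] mA.
have Abox : A `<=` `[- (M + 1), (M + 1)]%classic `*` `[- (M + 1), (M + 1)]%classic.
  have M1 : M < M + 1 by rewrite ltrDl.
  move=> x /(AM _ M1) /=.
  rewrite /Num.norm /= ge_max => /andP[x1 x2].
  by split; rewrite /= in_itv /= -ler_norml.
apply: (@le_lt_trans _ _
  (mu2 (`[- (M + 1), (M + 1)]%classic `*` `[- (M + 1), (M + 1)]%classic))).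
  by apply: le_measure; rewrite ?inE//; exact: measurableX.
rewrite mu2X// lte_mul_pinfty// lebesgue_measure_itv/=; case: ifP => //.
by rewrite -EFinD ltry.
Qed.

End PlaneMeasure.

Section LebesgueSpaces.
Context (R : realType) (W : set (R * R)).
Let plane := (measurableTypeR R * measurableTypeR R)%type.
Hypothesis oW : open W.

Let mW : measurable (W : set plane). Proof. exact: open_measurable_plane. Qed.

Lemma LpP p v : Lp W p v <->
  measurable_fun (W : set plane) (v : plane -> R) /\ (Lpnorm W p v < +oo)%E.
Proof.
split=> [|[mv vfin]].
  rewrite /Lp /= inE => /andP[]; rewrite !inE /= => mv vfin.
  by split => //; exact: (measurable_restrictT (v : plane -> R) mW).2.
rewrite /Lp /= inE; apply/andP; rewrite !inE /=; split => //.
exact: (measurable_restrictT (v : plane -> R) mW).1.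
Qed.

Lemma Lpnorm_triangle p v w u : Lp W p v -> Lp W p w -> 1 <= p ->
  (forall q, u q = v q + w q) -> (Lpnorm W p u <= Lpnorm W p v + Lpnorm W p w)%E.
Proof.
move=> /LpP[mv _] /LpP[mw _] p1 E.
exact: (@LnormD_triangle _ plane R mu2 W mW p v w u mv mw (fun q _ => E q) p1).
Qed.

Lemma LpD p v w : Lp W p v -> Lp W p w -> 1 <= p -> Lp W p (v + w).
Proof.
move=> vL wL p1; have [mv vfin] := (LpP _ _).1 vL; have [mw wfin] := (LpP _ _).1 wL.
apply/LpP; split; first exact: measurable_funD.
by rewrite (le_lt_trans (Lpnorm_triangle vL wL p1 _))// lte_add_pinfty.
Qed.

Lemma Lpnorm0 p : p != 0 -> Lpnorm W p 0 = 0%E.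
Proof.
move=> p_neq0; rewrite -(Lnorm0 mu2 (p := p%:E))//; congr (Lnorm _ _ _).
by apply/funext => q; rewrite /= patchE; case: ifP.
Qed.

Lemma LpB p v w : Lp W p v -> Lp W p w -> 1 <= p -> Lp W p (v - w).
Proof.
move=> vL wL p1; apply: LpD => //; have [mw wfin] := (LpP _ _).1 wL.
apply/LpP; split; first exact: measurable_funN.
by have := LnormD_opp mu2 W p w; rewrite /LnormD /Lpnorm => ->.
Qed.

End LebesgueSpaces.

Section Lipschitz.
Context (R : realType) (W : set (R * R)) (b : R * R -> R).

Lemma lipschitz_continuous_bounded : open W -> bounded_set W ->
  [lipschitz b x | x in closure W] ->
  (forall q, W q -> {for q, continuous b}) /\
  exists C : R, forall q, W q -> `|b q| <= C.
Proof.
move=> oW [N [_ WN]] b_lip.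
have [L L0 Lle] : exists2 L : R, 0 < L & forall q r, W q -> W r ->
    `|b q - b r| <= L * `|q - r|.
  have [A [_ lipA]] := b_lip; exists (`|A| + 1); first by rewrite ltr_wpDl.
  move=> q r Wq Wr; have A1 : A < `|A| + 1 by rewrite (le_lt_trans (ler_norm A))// ltrDl.
  by apply: (lipA _ A1 (q, r)); split => /=; exact: subset_closure.
split=> [q Wq|].
  apply/(@cvgrPdist_le _ _ _ (nbhs q)) => e e0.
  have eL0 : 0 < e / L by rewrite divr_gt0.
  have near_le : \forall r \near q, `|q - r| <= e / L.
    exact: (@cvgr_dist_le _ _ _ (nbhs q) _ id q _ _ eL0).
  apply: filterS2 near_le (open_nbhs_nbhs (conj oW Wq)) => r qr Wr.
  by rewrite (le_trans (Lle q r Wq Wr))// mulrC -ler_pdivlMr.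
have [[q0 Wq0]|W0] := pselect (W !=set0); last first.
  by exists 0 => q Wq; exfalso; apply: W0; exists q.
exists (`|b q0| + L * (2 * (`|N| + 1))) => q Wq.
have normN r : W r -> `|r| <= `|N| + 1.
  by apply: WN; rewrite (le_lt_trans (ler_norm N))// ltrDl.
rewrite -[b q](subrK (b q0)) addrC (le_trans (ler_normD _ _))// lerD2l.
rewrite (le_trans (Lle q q0 Wq Wq0))// ler_pM2l// (le_trans (ler_normB _ _))//.
by have := normN q Wq; have := normN q0 Wq0; lra.
Qed.

End Lipschitz.

(** * Triangles and finite element functions *)

Section Triangles.
Context (R : realType).
Implicit Types (p q x : R * R).

Lemma conv_hull3P p0 p1 p2 x : conv_hull [:: p0; p1; p2] x <->
  exists l0 l1 l2 : R, [/\ 0 <= l0, 0 <= l1, 0 <= l2, l0 + l1 + l2 = 1 &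
    x = l0 *: p0 + l1 *: p1 + l2 *: p2].
Proof.
split=> [[l [l0 l1 ->]]|[l0 [l1 [l2 [l0_ge0 l1_ge0 l2_ge0 l_sum ->]]]]].
  move: l1; rewrite !big_ord_recl !big_ord0 /= !addr0 !addrA => l1.
  by exists (l ord0), (l (lift ord0 ord0)), (l (lift ord0 (lift ord0 ord0))).
exists (fun i : 'I_3 => [:: l0; l1; l2]`_i); split.
- by case=> [[|[|[|]]]].
- by rewrite !big_ord_recl big_ord0 /= addr0 addrA.
- by rewrite !big_ord_recl big_ord0 /= addr0 addrA.
Qed.

Let det (e f : R * R) := e.1 * f.2 - e.2 * f.1.
Let perp (e : R * R) : R * R := (- e.2, e.1).

(** Barycentric coordinates are affine, and a point at which all of them are
    positive is interior; so a boundary point lies on one of three lines.  A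
    degenerate triangle is itself contained in a line. *)
Lemma triangle_boundary_null (T : 3.-tuple (R * R)) :
  mu2.-negligible (conv_hull T `\` interior (conv_hull T)).
Proof.
case/tupleP: T => p0 T; case/tupleP: T => p1 T; case/tupleP: T => p2 T.
rewrite (tuple0 T) /= {T}.
have line_negl n c : n != 0 ->
    mu2.-negligible (line n c : set (measurableTypeR R * measurableTypeR R)).
  move=> n0; exists (line n c); split => //; first exact: measurable_line.
  exact: null_line.
pose e1 := p1 - p0; pose e2 := p2 - p0.
have [det0|det_neq0] := eqVneq (det e1 e2) 0.
  have [n n0 [n1 n2]] : exists2 n : R * R, n != 0 & dot n e1 = 0 /\ dot n e2 = 0.
    have dot_perp e f : dot (perp e) f = det e f by rewrite /dot /perp /det /=; ring.
    have perp_neq0 e : e != 0 -> perp e != 0.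
      case: e => e f; apply: contra_neq => -[/eqP]; rewrite oppr_eq0 => /eqP -> /= ->.
      by [].
    have [e10|/perp_neq0 e1_neq0] := eqVneq e1 0.
      have [e20|/perp_neq0 e2_neq0] := eqVneq e2 0.
        exists (1, 0); first by apply/eqP => -[/eqP]; rewrite oner_eq0.
        by rewrite e10 e20 /dot /= !mulr0 addr0.
      exists (perp e2) => //; rewrite e10 !dot_perp /det/=; split; ring.
    exists (perp e1) => //; rewrite !dot_perp det0; split => //.
    by rewrite /det; ring.
  apply: negligibleS (line_negl n (dot n p0) n0) => x [/conv_hull3P].
  move=> [l0 [l1 [l2 [_ _ _ l_sum ->]]]] _.
  rewrite /line /= (_ : l0 = 1 - l1 - l2); last by rewrite -l_sum; ring.
  move: n1 n2; rewrite /dot /e1 /e2 /= /GRing.scale /= => n1 n2.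
  transitivity (n.1 * p0.1 + n.2 * p0.2 + l1 * (n.1 * (p1.1 - p0.1) + n.2 * (p1.2 - p0.2)) +
    l2 * (n.1 * (p2.1 - p0.1) + n.2 * (p2.2 - p0.2))); first by ring.
  by rewrite n1 n2; ring.
(* Since [dot n1 e2] and [dot n2 e1] are equal to [d], the functions [L1] and
   [L2] are the barycentric coordinates for [p1] and [p2]. *)
pose n1 := perp e1; pose n2 := - perp e2; pose d := det e1 e2.
pose L1 x := (dot n2 x - dot n2 p0) / d; pose L2 x := (dot n1 x - dot n1 p0) / d.
have L_comb l0 l1 l2 : l0 + l1 + l2 = 1 ->
    let x := l0 *: p0 + l1 *: p1 + l2 *: p2 in L1 x = l1 /\ L2 x = l2.
  move=> l_sum x; rewrite /L1 /L2 /x (_ : l0 = 1 - l1 - l2); last by rewrite -l_sum; ring.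
  split; apply: (mulIf det_neq0); rewrite divfK//;
    by rewrite /n1 /n2 /perp /dot /det /e1 /e2 /= /GRing.scale /=; ring.
have L_bary x : x = (1 - L1 x - L2 x) *: p0 + L1 x *: p1 + L2 x *: p2.
  have E (u v : R) : d * u = d * v -> u = v by apply: mulfI.
  have L1d : d * L1 x = dot n2 x - dot n2 p0 by rewrite mulrC divfK.
  have L2d : d * L2 x = dot n1 x - dot n1 p0 by rewrite mulrC divfK.
  move: (L1 x) (L2 x) L1d L2d => k1 k2 k1d k2d.
  rewrite [LHS]surjective_pairing [RHS]surjective_pairing; congr pair; apply: E;
    rewrite /= /GRing.scale /=.
    transitivity (d * p0.1 + (d * k1) * (p1.1 - p0.1) + (d * k2) * (p2.1 - p0.1)); last by ring.
    by rewrite k1d k2d /d /n1 /n2 /perp /dot /det /e1 /e2 /=; ring.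
  transitivity (d * p0.2 + (d * k1) * (p1.2 - p0.2) + (d * k2) * (p2.2 - p0.2)); last by ring.
  by rewrite k1d k2d /d /n1 /n2 /perp /dot /det /e1 /e2 /=; ring.
have n1_neq0 : n1 != 0.
  apply: contra_neq det_neq0 => n10.
  have : dot n1 e2 = 0 by rewrite n10 dot0l.
  by rewrite /n1 /perp /dot /det /= => <-; ring.
have n2_neq0 : n2 != 0.
  apply: contra_neq det_neq0 => n20.
  have : dot n2 e1 = 0 by rewrite n20 dot0l.
  by rewrite /n2 /perp /dot /det /= => <-; ring.
have n12_neq0 : n1 + n2 != 0.
  apply: contra_neq det_neq0 => n120.
  have : dot (n1 + n2) e1 = 0 by rewrite n120 dot0l.
  by rewrite /n1 /n2 /perp /dot /det /= => <-; ring.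
apply: negligibleS (negligibleU (negligibleU
    (line_negl n2 (dot n2 p0) n2_neq0) (line_negl n1 (dot n1 p0) n1_neq0))
    (line_negl (n1 + n2) (d + dot (n1 + n2) p0) n12_neq0)).
move=> x [/conv_hull3P [l0 [l1 [l2 [l0_ge0 l1_ge0 l2_ge0 l_sum xE]]]] x_bdry].
have [L1x L2x] : L1 x = l1 /\ L2 x = l2 by rewrite xE; exact: L_comb.
have d_L1 : dot n2 x = d * l1 + dot n2 p0 by rewrite -L1x /L1 mulrC divfK// subrK.
have d_L2 : dot n1 x = d * l2 + dot n1 p0 by rewrite -L2x /L2 mulrC divfK// subrK.
have [l1_0|l1_neq0] := eqVneq l1 0.
  by left; left; rewrite /line /= d_L1 l1_0 mulr0 add0r.
have [l2_0|l2_neq0] := eqVneq l2 0.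
  by left; right; rewrite /line /= d_L2 l2_0 mulr0 add0r.
have [l0_0|l0_neq0] := eqVneq l0 0.
  right; rewrite /line /= !dotDl d_L1 d_L2.
  have -> : l2 = 1 - l1 by rewrite -l_sum l0_0; ring.
  by ring.
exfalso; apply: x_bdry.
have L1c : L1 y @[y --> x] --> l1.
  rewrite -L1x /L1; apply: (@cvgMr_tmp _ _ (nbhs x)).
  by apply: (@cvgB _ _ _ (nbhs x)); [exact: dot_continuous|exact: cvg_cst].
have L2c : L2 y @[y --> x] --> l2.
  rewrite -L2x /L2; apply: (@cvgMr_tmp _ _ (nbhs x)).
  by apply: (@cvgB _ _ _ (nbhs x)); [exact: dot_continuous|exact: cvg_cst].
have L12c : L1 y + L2 y @[y --> x] --> l1 + l2 by exact: (@cvgD _ _ _ (nbhs x)).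
have l1_gt0 : 0 < l1 by rewrite lt_def l1_neq0.
have l2_gt0 : 0 < l2 by rewrite lt_def l2_neq0.
have l12_lt1 : l1 + l2 < 1.
  have : 0 < l0 by rewrite lt_def l0_neq0.
  by lra.
have near1 : \forall y \near x, 0 < L1 y by exact: (cvgr_gt _ L1c).
have near2 : \forall y \near x, 0 < L2 y by exact: (cvgr_gt _ L2c).
have near12 : \forall y \near x, L1 y + L2 y < 1 by exact: (cvgr_lt _ L12c).
apply: filterS3 near1 near2 near12 => y y1 y2 y12.
apply/conv_hull3P; exists (1 - L1 y - L2 y), (L1 y), (L2 y); split => //.
- by lra.
- exact: ltW.
- exact: ltW.
- by ring.
Qed.

End Triangles.

Section AffineGradient.
Context (R : realType).
Implicit Types (p g : R * R) (v : R * R -> R).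

Lemma partial_affine v p c g i : (\forall q \near p, v q = c + dot g q) ->
  partial i v p = xcoord i g.
Proof.
move=> v_aff; rewrite /partial /derive.
apply: cvg_lim => //.
have e_cvg : h *: axis i + p @[h --> (0 : R)] --> p.
  suff : h *: axis i + p @[h --> (0 : R)] --> 0 *: axis i + p.
    by rewrite scale0r add0r.
  apply: (@cvgD _ _ _ (nbhs (0 : R))); last exact: cvg_cst.
  by apply: (@cvgZr_tmp _ _ _ (nbhs (0 : R))); exact: cvg_id.
have near0 : \forall h \near (0 : R), v (h *: axis i + p) = c + dot g (h *: axis i + p).
  exact: e_cvg _ v_aff.
apply: cvg_near_cst; rewrite near_withinE; apply: filterS near0 => h vE h0.
rewrite /= vE (nbhs_singleton v_aff) dotDr dotZr.
rewrite (_ : _ - _ = h * dot g (axis i)); last by ring.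
rewrite /GRing.scale /= mulKf//.
by case: i {e_cvg vE} => /=; rewrite /dot /axis /=; ring.
Qed.

Lemma grad_affine v p c g : (\forall q \near p, v q = c + dot g q) ->
  grad v p = g.
Proof.
move=> v_aff; rewrite [RHS]surjective_pairing /grad.
by rewrite !(partial_affine _ v_aff).
Qed.

Lemma continuous_affine v p c g : (\forall q \near p, v q = c + dot g q) ->
  {for p, continuous v}.
Proof.
move=> v_aff; rewrite /prop_for /continuous_at (nbhs_singleton v_aff).
have aff_cvg : c + dot g q @[q --> p] --> c + dot g p.
  by apply: (@cvgD _ _ _ (nbhs p)); [exact: cvg_cst|exact: dot_continuous].
apply: cvg_trans aff_cvg; apply: near_eq_cvg.
by apply: filterS v_aff => q ->.
Qed.

End AffineGradient.

Section FiniteElementFunctions.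
Context (R : realType) (W : set (R * R)) (M : seq (3.-tuple (R * R))).
Let plane := (measurableTypeR R * measurableTypeR R)%type.
Hypotheses (oW : open W) (bW : bounded_set W) (tri : triangulation W M).

(** On this open set of full measure the finite element functions are locally
    affine. *)
Definition mesh_interior : set (R * R) :=
  W `&` \bigcup_(T in [set` M]) interior (conv_hull T).

Lemma open_mesh_interior : open mesh_interior.
Proof.
by apply: openI => //; apply: bigcup_open => T _; exact: open_interior.
Qed.

Lemma measurable_mesh_interior : measurable (mesh_interior : set plane).
Proof. apply: open_measurable_plane; exact: open_mesh_interior. Qed.

Lemma mesh_interiorW : mesh_interior `<=` W.
Proof. exact: subIsetl. Qed.

(** The triangles cover [W], so that a missing point lies on the boundary of one
    of them. *)
Lemma mesh_skeleton_null : mu2 (W `\` mesh_interior) = 0%E.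
Proof.
apply/negligibleP.
  apply: measurableD; first exact: open_measurable_plane.
  exact: measurable_mesh_interior.
pose T0 : 3.-tuple (R * R) := nseq_tuple 3 0.
pose F k : set plane := conv_hull (nth T0 M k) `\` interior (conv_hull (nth T0 M k)).
have Fnull k : mu2.-negligible (F k) by exact: triangle_boundary_null.
apply: negligibleS (negligible_bigcup Fnull).
move=> p [Wp nDp]; have [_ cover _] := tri.
have : closure W p by exact: subset_closure.
rewrite -cover => -[T TM Tp]; exists (index T M) => //=.
rewrite /F nth_index//; split => // intT; apply: nDp; split => //.
by exists T.
Qed.

Lemma mesh_interior_fin : (mu2 mesh_interior < +oo)%E.
Proof.
apply: bounded_mu2 measurable_mesh_interior.
by move: bW => [N [N_real WN]]; exists N; split => // r /WN Wr p /mesh_interiorW/Wr.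
Qed.

Lemma Vh_affine v p : Vh W M v -> mesh_interior p -> exists2 T, T \in M &
  nbhs p (conv_hull T) /\
  exists c g, forall q, conv_hull T q -> v q = c + dot g q.
Proof.
move=> [_ v_aff _] [Wp [T TM Tp]]; exists T => //; split => //.
exact: v_aff.
Qed.

Lemma Vh_continuous v p : Vh W M v -> mesh_interior p -> {for p, continuous v}.
Proof.
move=> vV /(Vh_affine vV)[T TM [nT [c [g vE]]]].
by apply: (@continuous_affine _ v p c g); apply: filterS nT => q /vE.
Qed.

(** The gradient is locally constant off the skeleton. *)
Lemma Vh_partial_continuous v p i : Vh W M v -> mesh_interior p ->
  {for p, continuous (partial i v)}.
Proof.
move=> vV /(Vh_affine vV)[T TM [nT [c [g vE]]]].
have part q : nbhs q (conv_hull T) -> partial i v q = xcoord i g.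
  by move=> nqT; apply: (@partial_affine _ v q c); apply: filterS nqT => r /vE.
rewrite /prop_for /continuous_at (part p nT); apply: cvg_near_cst.
by apply: filterS (nbhs_interior nT) => q /part.
Qed.

Lemma measurable_Vh v : Vh W M v ->
  measurable_fun (mesh_interior : set plane) (v : plane -> R).
Proof.
move=> vV; apply: continuous_measurable_plane; first exact: open_mesh_interior.
by move=> x; exact: Vh_continuous.
Qed.

Lemma measurable_Vh_partial v i : Vh W M v ->
  measurable_fun (mesh_interior : set plane) (partial i v : plane -> R).
Proof.
move=> vV; apply: continuous_measurable_plane; first exact: open_mesh_interior.
by move=> x; exact: Vh_partial_continuous.
Qed.

Lemma Vh_bounded v : Vh W M v -> exists C : R, forall p, mesh_interior p ->
  `|v p| <= C /\ `|grad v p| <= C.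
Proof.
move=> vV; have [_ v_aff _] := vV.
have /choice[cg cgE] : forall T, exists cg : R * (R * R), T \in M ->
    forall q, conv_hull T q -> v q = cg.1 + dot cg.2 q.
  move=> T; have [TM|] := boolP (T \in M); last by exists 0.
  by have [c [g vE]] := v_aff T TM; exists (c, g).
have [N N0 WN] : exists2 N : R, 0 <= N & forall p, W p -> `|p| <= N.
  move: bW => [N [_ WN]]; exists (`|N| + 1); first by rewrite addr_ge0.
  by move=> p; apply: WN; rewrite (le_lt_trans (ler_norm N))// ltrDl.
pose B T := `|(cg T).1| + 2 * `|(cg T).2| * N + `|(cg T).2|.
have B0 T : 0 <= B T by rewrite !addr_ge0// !mulr_ge0.
exists (\sum_(T <- M) B T) => p Dp.
have [T TM [nT _]] := Vh_affine vV Dp.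
have vE q : conv_hull T q -> v q = (cg T).1 + dot (cg T).2 q by exact: cgE.
have gradE : grad v p = (cg T).2.
  by apply: (@grad_affine _ v p (cg T).1); apply: filterS nT.
have B_le : B T <= \sum_(T <- M) B T.
  by rewrite (big_rem T)//= lerDl sumr_ge0.
rewrite gradE vE; last exact: nbhs_singleton nT.
have ? := normr_ge0 (cg T).1; have ? := normr_ge0 (cg T).2.
have ? : 0 <= 2 * `|(cg T).2| * N by rewrite !mulr_ge0.
split; apply: le_trans B_le; last by rewrite /B lerDr addr_ge0.
rewrite /B (le_trans (ler_normD _ _))// -addrA lerD2l.
rewrite (le_trans (dot_le _ _))// (@le_trans _ _ (2 * `|(cg T).2| * N))//.
  by rewrite ler_wpM2l ?mulr_ge0// WN//; exact: mesh_interiorW.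
by rewrite lerDl.
Qed.

Lemma Vh_grad_comb n (phi : 'I_n -> R * R -> R) (x : 'rV[R]_n) p :
  (forall i, Vh W M (phi i)) -> mesh_interior p ->
  grad (fun q => \sum_i x 0 i * phi i q) p =
  (\sum_i x 0 i * partial false (phi i) p, \sum_i x 0 i * partial true (phi i) p).
Proof.
move=> phiV Dp; have [Wp [T TM nT]] := Dp.
have /choice[cg cgE] : forall i, exists cg : R * (R * R),
    forall q, conv_hull T q -> phi i q = cg.1 + dot cg.2 q.
  by move=> i; have [_ + _] := phiV i => /(_ T TM)[c [g E]]; exists (c, g).
have partE i j : partial j (phi i) p = xcoord j (cg i).2.
  by apply: (@partial_affine _ (phi i) p (cg i).1); apply: filterS nT; exact: cgE.
apply: (@grad_affine _ _ _ (\sum_i x 0 i * (cg i).1)).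
apply: filterS nT => q Tq.
rewrite /dot /= !mulr_suml -!big_split; apply: eq_bigr => i _ /=.
by rewrite cgE// !partE /dot /=; ring.
Qed.

(** Where the gradient does not vanish, a level set meets each triangle in a
    line. *)
Lemma Vh_level_null v t : Vh W M v ->
  {ae mu2, forall p, mesh_interior p -> v p != t \/ grad v p = 0}.
Proof.
move=> vV; have [_ v_aff _] := vV.
have /choice[cg cgE] : forall T, exists cg : R * (R * R), T \in M ->
    forall q, conv_hull T q -> v q = cg.1 + dot cg.2 q.
  move=> T; have [TM|] := boolP (T \in M); last by exists 0.
  by have [c [g vE]] := v_aff T TM; exists (c, g).
pose T0 : 3.-tuple (R * R) := nseq_tuple 3 0.
pose F k := let T := nth T0 M k in
  [set p | (cg T).2 != 0 /\ line (cg T).2 (t - (cg T).1) p].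
have Fnull k : mu2.-negligible (F k : set plane).
  rewrite /F; set T := nth T0 M k; have [g0|g_neq0] := eqVneq (cg T).2 0.
    by apply: negligibleS (negligible_set0 _) => p [/eqP].
  exists (line (cg T).2 (t - (cg T).1)); split => [||p []//].
    exact: measurable_line.
  exact: null_line.
apply: negligibleS (negligible_bigcup Fnull) => p /= /not_implyP[Dp].
move=> /not_orP[/negP/negPn/eqP vt /eqP grad_neq0].
have [T TM [nT _]] := Vh_affine vV Dp.
exists (index T M) => //; rewrite /F nth_index//=.
have gradE : grad v p = (cg T).2.
  by apply: (@grad_affine _ v p (cg T).1); apply: filterS nT => q; exact: cgE.
split; first by rewrite -gradE.
by rewrite /line /= -vt (cgE T TM p (nbhs_singleton nT)) addrAC subrr add0r.
Qed.

End FiniteElementFunctions.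

(** * A basis of the finite element space *)

Section FiniteDimension.
Context (F : fieldType) (E : lmodType F) (N : nat).
Variables (X : set E) (c : E -> 'rV[F]_N).
Hypotheses (X0 : X 0) (X_lin : forall k u v, X u -> X v -> X (k *: u + v)).
Hypothesis c_lin : forall k u v, c (k *: u + v) = k *: c u + c v.
Hypothesis c_inj : forall v, X v -> c v = 0 -> v = 0.

Let c0 : c 0 = 0.
Proof. by have := c_lin (-1) 0 0; rewrite scaler0 add0r scaleN1r addNr. Qed.

Lemma sum_closed n (x : 'rV[F]_n) (phi : 'I_n -> E) :
  (forall i, X (phi i)) -> X (\sum_i x 0 i *: phi i).
Proof.
move=> phiX; apply: (big_ind X) => // [u v Xu Xv|i _].
  by have := X_lin 1 Xu Xv; rewrite scale1r.
by have := X_lin (x 0 i) (phiX i) X0; rewrite addr0.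
Qed.

Let c_sum n (x : 'rV[F]_n) (phi : 'I_n -> E) :
  c (\sum_i x 0 i *: phi i) = x *m \matrix_i c (phi i).
Proof.
rewrite mulmx_sum_row.
elim: (index_enum _) => [|i r IHr]; first by rewrite !big_nil c0.
by rewrite !big_cons c_lin IHr rowK.
Qed.

(** Take a family in [X] of maximal size among those whose images under [c] are
    independent: the image of any element of [X] depends on them, and [c] is
    injective on [X]. *)
Lemma finite_basis : exists n (phi : 'I_n -> E), (forall i, X (phi i)) /\
  forall v, X v -> exists! x : 'rV[F]_n, v = \sum_i x 0 i *: phi i.
Proof.
pose P n := `[< exists phi : 'I_n -> E,
  (forall i, X (phi i)) /\ row_free (\matrix_i c (phi i)) >].
have P0 : exists n, P n.
  exists 0%N; apply/asboolP; exists (fun=> 0); split => //.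
  by rewrite /row_free -leqn0 rank_leq_row.
have P_le n : P n -> (n <= N)%N.
  by move=> /asboolP[phi [_ /eqP <-]]; exact: rank_leq_col.
case: (ex_maxnP P0 P_le) => n /asboolP[phi [phiX phi_free]] n_max.
exists n, phi; split => // v Xv; set A := \matrix_i c (phi i) in phi_free.
have vA : (c v <= A)%MS.
  apply/negPn/negP => vNA; suff : P n.+1 by move=> /n_max; rewrite ltnn.
  apply/asboolP; exists (fun k : 'I_(1 + n) => match fintype.split k with
    inl _ => v | inr i => phi i end).
  split => [i|]; first by case: (fintype.split (i : 'I_(1 + n))).
  rewrite (_ : \matrix_(i < 1 + n) _ = col_mx (c v) A); last first.
    apply/(@row_matrixP _ (1 + n)) => k; rewrite rowK -[in RHS](splitK k).
    case: (fintype.split k) => i /=; first by rewrite rowKu [i]ord1 row_id.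
    by rewrite rowKd rowK.
  have rankE : \rank (col_mx (c v) A) = \rank (c v + A)%MS by rewrite addsmxE.
  apply/eqP; rewrite [LHS]rankE; apply/eqP; rewrite eqn_leq; apply/andP; split.
    by rewrite -rankE; exact: (rank_leq_row (col_mx (c v) A)).
  have : (A < c v + A)%MS.
    by rewrite ltmxE addsmxSr/=; apply: contra vNA => /(submx_trans _) -> //; exact: addsmxSl.
  by move=> /rank_ltmx; rewrite (eqP phi_free).
have /submxP[x xE] := vA; exists x; split.
  apply/eqP; rewrite -subr_eq0; apply/eqP; apply: c_inj.
    have := X_lin (-1) (sum_closed x phiX) Xv; by rewrite scaleN1r addrC.
  by rewrite addrC -scaleN1r c_lin c_sum xE scaleN1r addNr.
move=> y vE; apply: (row_free_inj phi_free).
by rewrite -xE vE c_sum.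
Qed.

End FiniteDimension.

Section FiniteElementBasis.
Context (R : realType) (W : set (R * R)) (M : seq (3.-tuple (R * R))).
Hypothesis tri : triangulation W M.

Lemma Vh0 : Vh W M 0.
Proof.
split=> // [|T TM]; first by move=> x; exact: cvg_cst.
by exists 0, 0 => x _; rewrite dot0l addr0.
Qed.

Lemma Vh_linear k v w : Vh W M v -> Vh W M w -> Vh W M (k *: v + w).
Proof.
move=> [cv av v0] [cw aw w0]; split => [x|T TM|x nWx].
- apply: (@cvgD _ _ _ (nbhs x)); last exact: cw.
  by apply: (@cvgZl_tmp _ _ _ (nbhs x)); exact: cv.
- have [c [g vE]] := av T TM; have [c' [g' wE]] := aw T TM.
  exists (k * c + c'), (k *: g + g') => x Tx.
  rewrite dotDl dotZl; transitivity (k * v x + w x); first by [].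
  by rewrite vE// wE//; ring.
- by transitivity (k * v x + w x) => //; rewrite v0// w0// mulr0 addr0.
Qed.

Let nodes : seq (R * R) := flatten (map val M).

Definition nodal_values (v : R * R -> R) : 'rV[R]_(size nodes) :=
  \row_k v (nth 0 nodes k).

(** An affine function on a triangle is determined by its values at the
    vertices. *)
Lemma nodal_values_eq0 v : Vh W M v -> nodal_values v = 0 -> v = 0.
Proof.
move=> [_ v_aff v0] vn; have [_ cover _] := tri; apply/funext => x.
have [Wx|] := pselect (W x); last exact: v0.
have : closure W x by exact: subset_closure.
rewrite -cover => -[T TM [l [l_ge0 l_sum xE]]].
have [c [g vE]] := v_aff T TM.
have v_node i : (i < size T)%N -> v T`_i = 0.
  move=> iT; have : T`_i \in nodes.
    by apply/flattenP; exists (val T); [exact: map_f|exact: mem_nth].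
  move=> /(nthP 0)[k kn <-].
  by have /rowP/(_ (Ordinal kn)) := vn; rewrite !mxE.
have hull_node i : (i < size T)%N -> conv_hull T T`_i.
  move=> iT; exists (fun j => (j == Ordinal iT)%:R); split => [j||].
  - by rewrite ler0n.
  - by rewrite (bigD1 (Ordinal iT))//= eqxx big1 ?addr0// => j /negbTE ->.
  - rewrite (bigD1 (Ordinal iT))//= eqxx scale1r big1 ?addr0// => j /negbTE ->.
    by rewrite scale0r.
have -> : v x = \sum_i l i * v T`_i.
  rewrite vE; last by exists l.
  rewrite (eq_bigr (fun i => l i * c + l i * dot g T`_i)); last first.
    by move=> i _; rewrite vE ?mulrDr//; exact: hull_node.
  rewrite big_split -mulr_suml l_sum mul1r /= xE; congr (_ + _).
  elim: (index_enum _) => [|i r IHr]; first by rewrite !big_nil /dot /= !mulr0 addr0.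
  by rewrite !big_cons dotDr dotZr IHr.
by rewrite big1// => i _; rewrite v_node ?mulr0.
Qed.

Lemma Vh_basis : exists n (phi : 'I_n -> R * R -> R), (forall i, Vh W M (phi i)) /\
  forall v, Vh W M v -> exists! x : 'rV[R]_n, v = \sum_i x 0 i *: phi i.
Proof.
apply: (@finite_basis R (R * R -> R) _ (Vh W M) nodal_values).
- exact: Vh0.
- exact: Vh_linear.
- by move=> k u v; apply/rowP => i; rewrite !mxE.
- exact: nodal_values_eq0.
Qed.

End FiniteElementBasis.

Section Interpolation.
Context (R : realType) (W : set (R * R)) (M : seq (3.-tuple (R * R))).
Let plane := (measurableTypeR R * measurableTypeR R)%type.
Hypotheses (oW : open W) (bW : bounded_set W) (tri : triangulation W M).
Variables (n : nat) (phi : 'I_n -> R * R -> R).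
Hypothesis phiV : forall i, Vh W M (phi i).
Hypothesis phi_basis : forall v, Vh W M v ->
  exists! x : 'rV[R]_n, v = \sum_i x 0 i *: phi i.

Definition interp (x : 'rV[R]_n) : R * R -> R := \sum_i x 0 i *: phi i.

Let D := mesh_interior W M.
Let d1 i := partial false (phi i).
Let d2 i := partial true (phi i).

Lemma interpE x p : interp x p = comb phi x p.
Proof. by rewrite /interp fct_sumE. Qed.

Lemma interp_Vh x : Vh W M (interp x).
Proof.
by apply: sum_closed => //; [exact: Vh0|exact: Vh_linear].
Qed.

Lemma interp_linear c x y : interp (c *: x + y) = c *: interp x + interp y.
Proof.
apply/funext => p; rewrite interpE combD combZ.
by transitivity (c * interp x p + interp y p) => //; rewrite !interpE.
Qed.

Lemma interpB x y : interp (x - y) = interp x - interp y.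
Proof. by rewrite addrC -scaleN1r interp_linear scaleN1r addrC. Qed.

Lemma interp_inj : injective interp.
Proof.
move=> x y xy; have [z [_ z_uniq]] := phi_basis (interp_Vh x).
by rewrite -(z_uniq x)// (z_uniq y).
Qed.

Lemma interp_surj v : Vh W M v -> exists x, v = interp x.
Proof. by move=> /phi_basis[x [-> _]]; exists x. Qed.

Lemma grad_interp x p : D p -> grad (interp x) p = gcomb d1 d2 x p.
Proof.
move=> Dp; rewrite (_ : interp x = fun q => \sum_i x 0 i * phi i q).
  exact: Vh_grad_comb Dp.
by apply/funext => q; rewrite interpE.
Qed.

Lemma integral2_mesh f g : (forall p, D p -> f p = g p) ->
  integral2 W f = \int[mu2]_(p in (D : set plane)) g p.
Proof.
move=> fg; have mW : measurable (W : set plane) by exact: open_measurable_plane.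
have mD : measurable (D : set plane) by exact: measurable_mesh_interior.
apply: (@Rintegral_eq_off_null _ plane R mu2 (W `\` D)).
- exact: measurableD.
- exact: mesh_skeleton_null.
- move=> p nWD; rewrite !patchE; case: ifPn => [/set_mem Wp|/negP nWp].
    case: ifPn => [/set_mem Dp|/negP nDp]; first exact: fg.
    by exfalso; apply: nWD; split => // /mem_set.
  by case: ifPn => // /set_mem /mesh_interiorW /mem_set.
Qed.

Lemma Lpnorm_mesh p f : Lpnorm W p f = LnormD mu2 (D : set plane) p f.
Proof.
apply: (@Lnorm_restrict_null _ plane) => //.
- exact: measurable_mesh_interior.
- exact: open_measurable_plane.
- exact: mesh_interiorW.
- exact: mesh_skeleton_null.
Qed.

(** The level set of a finite element function at [tbar] is null off the
    triangles on which the function is constant. *)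
Lemma mesh_shapes (b : R * R -> R) tbar (bB : R) :
  (forall p, W p -> {for p, continuous b}) -> (forall p, W p -> `|b p| <= bB) ->
  exists B, @shape_family _ plane R mu2 D n phi d1 d2 b tbar B.
Proof.
move=> b_cont b_le.
have /choice[C C_le] := fun i => Vh_bounded bW (phiV i).
pose B := `|bB| + \sum_i `|C i|.
have B_ge i : C i <= B.
  rewrite /B (bigD1 i)//= (le_trans (ler_norm _))// addrCA lerDl addr_ge0// sumr_ge0//.
exists B; split.
- by split; [exact: measurable_mesh_interior|exact: mesh_interior_fin].
- by rewrite addr_ge0// sumr_ge0.
- apply: continuous_measurable_plane; first exact: open_mesh_interior.
  by move=> p /mesh_interiorW; exact: b_cont.
- move=> p /mesh_interiorW /b_le /le_trans; apply.
  by rewrite (le_trans (ler_norm _))// lerDl sumr_ge0.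
- by move=> i; exact: measurable_Vh.
- by move=> i; split; exact: measurable_Vh_partial.
- by move=> i p Dp; rewrite (le_trans _ (B_ge i))//; case: (C_le i p Dp).
- move=> i p Dp; have [_ +] := C_le i p Dp; rewrite /Num.norm /= ge_max => /andP[le1 le2].
  by rewrite (le_trans le1)// (le_trans le2).
- move=> x; have [N [mN N0 subN]] := Vh_level_null tbar (interp_Vh x).
  exists N; split => // p nP; apply: subN => /= level; apply: nP => Dp.
  by have := level Dp; rewrite interpE grad_interp.
Qed.

End Interpolation.

(** * The discrete state equation in coordinates *)

Section DiscreteProblem.
Context (R : realType) (W : set (R * R)) (M : seq (3.-tuple (R * R))).
Let plane := (measurableTypeR R * measurableTypeR R)%type.
Hypotheses (oW : open W) (bW : bounded_set W) (tri : triangulation W M).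
Variables (n : nat) (phi : 'I_n -> R * R -> R).
Hypothesis phiV : forall i, Vh W M (phi i).
Hypothesis phi_basis : forall v, Vh W M v ->
  exists! x : 'rV[R]_n, v = \sum_i x 0 i *: phi i.
Variables (b : R * R -> R) (a da : R -> R) (tbar B : R).

Let D := mesh_interior W M.
Let d1 i := partial false (phi i).
Let d2 i := partial true (phi i).

Hypothesis shapes : @shape_family _ plane R mu2 D n phi d1 d2 b tbar B.
Hypothesis a_kinked : kinked tbar a da.

Let mD : measurable (D : set plane). Proof. exact: measurable_mesh_interior. Qed.
Let mW : measurable (W : set plane). Proof. exact: open_measurable_plane. Qed.
Let Dfin : (mu2 D < +oo)%E. Proof. exact: mesh_interior_fin. Qed.

Lemma Lp_restrict p v : Lp W p v ->
  [/\ measurable_fun (W : set plane) (v : plane -> R),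
      measurable_fun (D : set plane) (v : plane -> R) &
      (Lpnorm W p v < +oo)%E].
Proof.
move=> /(LpP oW)[mv vfin].
by split => //; exact: (measurable_funS mW (@mesh_interiorW _ W M) mv).
Qed.

Lemma state_form_interp x w :
  integral2 W (fun p => (b p + a (interp phi x p)) *
    dot (grad (interp phi x) p) (grad (interp phi w) p)) =
  @state_form _ plane R mu2 D n phi d1 d2 b a x w.
Proof.
apply: integral2_mesh => // p Dp.
by rewrite interpE !(grad_interp phiV)//.
Qed.

Lemma Dform_interp x z w :
  Dform W b a da (interp phi x) (interp phi z) (interp phi w) =
  @dstate_form _ plane R mu2 D n phi d1 d2 b a da x z w.
Proof.
apply: integral2_mesh => // p Dp.
by rewrite !interpE !(grad_interp phiV)//.
Qed.

(** The coordinates of the functional w |-> int u w on [Vh]. *)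
Definition load (u : R * R -> R) : 'rV[R]_n :=
  \row_j integral2 W (fun p => u p * phi j p).

Let weight_hoelder (g : plane -> R) C : measurable_fun (D : set plane) g ->
  (forall p, D p -> `|g p| <= C) ->
  exists2 m : R, 0 <= m & forall u, Lp W 2 u ->
  mu2.-integrable (D : set plane) (EFin \o (u \* g)) /\
  (`|\int[mu2]_(p in (D : set plane)) (u p * g p)|%:E <= m%:E * Lpnorm W 2 u)%E.
Proof.
move=> mg gC.
have [m m0 mle] := @LnormD_hoelder _ plane R mu2 D mD 2 g C Dfin (ltr1n _ _) mg gC.
exists m => // u uL2; rewrite (Lpnorm_mesh oW tri).
have [_ mu ufin] := Lp_restrict uL2.
by apply: mle => //; rewrite -(Lpnorm_mesh oW tri).
Qed.

Let load_hoelder j := weight_hoelder (shape_measurable shapes j) (shape_le shapes j).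

Lemma load_bounded : exists2 C : R, 0 <= C & forall v, Lp W 2 v ->
  (`|load v|%:E <= C%:E * Lpnorm W 2 v)%E.
Proof.
have /choice[m mle] : forall j, exists m : R, 0 <= m /\ forall u, Lp W 2 u ->
    (`|\int[mu2]_(p in (D : set plane)) (u p * phi j p)|%:E <= m%:E * Lpnorm W 2 u)%E.
  move=> j; have [m m0 mle] := load_hoelder j.
  by exists m; split => // u /mle[].
have m0 j : 0 <= m j by case: (mle j).
exists (\sum_j m j); first exact: sumr_ge0.
move=> v vL2; have [_ _ vfin] := Lp_restrict vL2.
have vE : Lpnorm W 2 v = (fine (Lpnorm W 2 v))%:E.
  by rewrite fineK// ge0_fin_numE// Lnorm_ge0.
rewrite vE -EFinM lee_fin.
have v0 : 0 <= fine (Lpnorm W 2 v) by rewrite fine_ge0// Lnorm_ge0.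
apply: mx_norm_le => [|i j]; first by rewrite mulr_ge0// sumr_ge0.
rewrite mxE (integral2_mesh oW tri (g := fun p => v p * phi j p))//.
have := (mle j).2 v vL2; rewrite vE -EFinM lee_fin => /le_trans; apply.
by rewrite ler_wpM2r// (bigD1 j)//= lerDl sumr_ge0.
Qed.

Lemma load_linear c u v : Lp W 2 u -> Lp W 2 v ->
  load (c *: u + v) = c *: load u + load v.
Proof.
move=> uL2 vL2; apply/rowP => j; rewrite !mxE.
rewrite (integral2_mesh oW tri (g := fun p => (c * u p + v p) * phi j p))//.
rewrite (integral2_mesh oW tri (g := fun p => u p * phi j p))//.
rewrite (integral2_mesh oW tri (g := fun p => v p * phi j p))//.
have [m _ mle] := load_hoelder j.
have [intu _] := mle u uL2; have [intv _] := mle v vL2.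
rewrite -RintegralZl// -RintegralD//; last exact: (integrableZl mD c intu).
apply: eq_Rintegral => p _.
by ring.
Qed.

Lemma load_interp u w : Lp W 2 u ->
  integral2 W (fun p => u p * interp phi w p) = \sum_j w 0 j * load u 0 j.
Proof.
move=> uL2; rewrite (integral2_mesh oW tri (g := fun p => u p * comb phi w p)); last first.
  by move=> p _; rewrite interpE.
pose L w := \int[mu2]_(p in (D : set plane)) (u p * comb phi w p).
have intL y : mu2.-integrable (D : set plane) (EFin \o (u \* comb phi y)).
  have [m _ mle] := weight_hoelder (@measurable_comb _ plane R D n phi y
    (shape_measurable shapes)) (comb_phi_le shapes y).
  by have [] := mle u uL2.
rewrite -/(L w) (@linear_row_sum _ _ L); last first.
  move=> c y y'; rewrite /L -RintegralZl//; last exact: intL.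
  have intcL := integrableZl mD c (intL y).
  rewrite [RHS](_ : _ = \int[mu2]_(p in (D : set plane))
      (c * (u p * comb phi y p) + u p * comb phi y' p)).
    by apply: eq_Rintegral => p _; rewrite combD combZ /=; ring.
  by symmetry; apply: RintegralD => //; exact: intL.
apply: eq_bigr => j _; rewrite mxE /L; congr (_ * _).
rewrite (integral2_mesh oW tri (g := fun p => u p * phi j p))//.
by apply: eq_Rintegral => p _; rewrite comb_delta.
Qed.

Let F := @state_fun _ plane R mu2 D n phi d1 d2 b a.
Let J := @state_jac _ plane R mu2 D n phi d1 d2 b a da.

Let sum_delta (l : 'rV[R]_n) j : \sum_k (delta_mx 0 j : 'rV[R]_n) 0 k * l 0 k = l 0 j.
Proof.
rewrite (bigD1 j)//= mxE !eqxx mul1r big1 ?addr0// => k /negbTE kj.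
by rewrite mxE eqxx kj mul0r.
Qed.

(** Both sides of the discrete state equation are linear in the test function,
    so that it may be tested on the basis. *)
Lemma discrete_stateP u x : Lp W 2 u ->
  discrete_state W M b a u (interp phi x) <-> F x = load u.
Proof.
move=> uL2; split => [state|Fx w wV].
  apply/rowP => j; rewrite -(sum_delta (load u) j) -load_interp// mxE.
  by rewrite -state; [rewrite state_form_interp|exact: interp_Vh].
have [y ->] := interp_surj phi_basis wV.
rewrite state_form_interp load_interp// -Fx.
rewrite (linear_row_sum y (state_form_linear2 shapes a_kinked x)).
by apply: eq_bigr => j _; rewrite mxE.
Qed.

Lemma linearizedP x z (l : 'rV[R]_n) :
  (forall w, dstate_form mu2 (D : set plane) phi d1 d2 b a da x z w =
    \sum_j w 0 j * l 0 j) <-> z *m J x = l.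
Proof.
split => [form|zJ w].
  apply/rowP => j; rewrite (mul_state_jac shapes a_kinked) form.
  exact: sum_delta.
rewrite (linear_row_sum w (dstate_form_linear2 shapes a_kinked x z)).
by apply: eq_bigr => j _; rewrite -zJ (mul_state_jac shapes a_kinked).
Qed.

(** A vector in the kernel of the Jacobian gives a finite element function on
    which the linearized form vanishes; the zero function is another one. *)
Lemma D_iso_unit x : D_iso W M b a da (interp phi x) -> J x \in unitmx.
Proof.
move=> iso; rewrite -row_free_unit -kermx_eq0; apply/eqP/row_matrixP => i.
rewrite row0; set z := row i _.
have zJ : z *m J x = 0 by rewrite -row_mul mulmx_ker row0.
have form0 (y : 'rV_n) : y *m J x = 0 ->
    forall w, Vh W M w -> Dform W b a da (interp phi x) (interp phi y) w = 0.
  move=> yJ w /(interp_surj phi_basis)[v ->]; rewrite Dform_interp.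
  by rewrite ((linearizedP _ _ _).2 yJ) big1// => j _; rewrite mxE mulr0.
have [|y [_ y_uniq]] := iso (fun=> 0).
  by move=> c v w _ _; rewrite scaler0 addr0.
apply: (interp_inj phiV phi_basis); transitivity y.
  symmetry; apply: y_uniq; split; first exact: interp_Vh.
  by move=> w wV; exact: form0.
apply: y_uniq; split; first exact: interp_Vh.
by move=> w wV; apply: form0 => //; rewrite mul0mx.
Qed.

Lemma linearized_unique x v : J x \in unitmx -> Lp W 2 v ->
  unique (fun z => Vh W M z /\ forall w, Vh W M w ->
    Dform W b a da (interp phi x) z w = integral2 W (fun p => v p * w p))
  (interp phi (load v *m invmx (J x))).
Proof.
move=> Jx vL2; split.
  split; first exact: interp_Vh.
  move=> w /(interp_surj phi_basis)[y ->]; rewrite Dform_interp load_interp//.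
  by apply: (linearizedP _ _ _).2; rewrite mulmxKV.
move=> z [/(interp_surj phi_basis)[y ->] form].
congr interp; apply: (canLR (mulmxK Jx)); symmetry; apply/linearizedP => w.
by rewrite -Dform_interp form ?load_interp//; exact: interp_Vh.
Qed.

End DiscreteProblem.

Section DiscreteNorm.
Context (R : realType) (W : set (R * R)) (M : seq (3.-tuple (R * R))).
Let plane := (measurableTypeR R * measurableTypeR R)%type.
Hypotheses (oW : open W) (bW : bounded_set W) (tri : triangulation W M).
Variables (n : nat) (phi : 'I_n -> R * R -> R).
Hypothesis phiV : forall i, Vh W M (phi i).
Variables (b : R * R -> R) (a da : R -> R) (tbar B : R).

Let D := mesh_interior W M.
Let d1 i := partial false (phi i).
Let d2 i := partial true (phi i).

Hypothesis shapes : @shape_family _ plane R mu2 D n phi d1 d2 b tbar B.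
Hypothesis a_kinked : kinked tbar a da.
Variable p : R.
Hypothesis p1 : 1 < p.

Let mD : measurable (D : set plane). Proof. exact: measurable_mesh_interior. Qed.
Let Dfin : (mu2 D < +oo)%E. Proof. exact: mesh_interior_fin. Qed.
Let p0 : 0 < p. Proof. by rewrite (lt_trans _ p1). Qed.
Let mg1 i := (shape_measurable_grad shapes i).1.
Let mg2 i := (shape_measurable_grad shapes i).2.

Lemma W1norm_mesh v dv : W1norm W p v dv =
  (LnormD mu2 (D : set plane) p v + LnormD mu2 (D : set plane) p (fst \o dv) +
   LnormD mu2 (D : set plane) p (snd \o dv))%E.
Proof. by rewrite /W1norm !(Lpnorm_mesh oW tri). Qed.

Definition mesh_measurable (v : R * R -> R) (dv : R * R -> R * R) : Prop :=
  [/\ measurable_fun (D : set plane) (v : plane -> R),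
      measurable_fun (D : set plane) (fst \o dv : plane -> R) &
      measurable_fun (D : set plane) (snd \o dv : plane -> R)].

Lemma W1norm_triangle v dv w dw u du : mesh_measurable v dv ->
  mesh_measurable w dw ->
  (forall q, D q -> u q = v q + w q /\ du q = dv q + dw q) ->
  (W1norm W p u du <= W1norm W p v dv + W1norm W p w dw)%E.
Proof.
move=> [mv mv1 mv2] [mw mw1 mw2] E; rewrite !W1norm_mesh.
have p1' := ltW p1.
have le0 := @LnormD_triangle _ plane R mu2 D mD p v w u mv mw
  (fun q Dq => (E q Dq).1) p1'.
have le1 := @LnormD_triangle _ plane R mu2 D mD p _ _ (fst \o du) mv1 mw1
  (fun q Dq => congr1 fst (E q Dq).2) p1'.
have le2 := @LnormD_triangle _ plane R mu2 D mD p _ _ (snd \o du) mv2 mw2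
  (fun q Dq => congr1 snd (E q Dq).2) p1'.
apply: le_trans (leeD (leeD le0 le1) le2) _.
have regroup (e e' f f' g g' : \bar R) :
    (e + e' + (f + f') + (g + g') = e + f + g + (e' + f' + g'))%E.
  by rewrite (addeACA e e' f f') (addeACA (e + f)%E (e' + f')%E g g').
by rewrite regroup.
Qed.

Lemma interp_measurable x : mesh_measurable (interp phi x) (grad (interp phi x)).
Proof.
have xV := interp_Vh phiV x.
by split; [exact: measurable_Vh|exact: (measurable_Vh_partial oW false xV)|
  exact: (measurable_Vh_partial oW true xV)].
Qed.

Let nY z := W1norm W p (interp phi z) (grad (interp phi z)).

Let nYE z : nY z = shape_norm mu2 (D : set plane) phi d1 d2 p z.
Proof.
rewrite /nY W1norm_mesh /shape_norm; congr (_ + _ + _)%E; apply: eq_LnormD => q Dq /=.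
- exact: interpE.
- by rewrite (_ : partial false _ q = (grad (interp phi z) q).1)// (grad_interp phiV).
- by rewrite (_ : partial true _ q = (grad (interp phi z) q).2)// (grad_interp phiV).
Qed.

Lemma W1norm_interp_le : exists2 C : R, 0 <= C &
  forall z : 'rV[R]_n, (nY z <= (C * `|z|)%:E)%E.
Proof.
have [C C0 C_le] := shape_norm_le shapes p1.
by exists C => // z; rewrite nYE.
Qed.

Let nY_fin z : nY z \is a fin_num.
Proof. rewrite nYE; exact: (shape_norm_fin shapes p1). Qed.

Variables (y : R * R -> R) (dy : R * R -> R * R) (kappa : R).
Hypothesis my : mesh_measurable y dy.

Let ball_norm x : \bar R :=
  W1norm W p (interp phi x - y) (grad (interp phi x) - dy).

Let diff_measurable x : mesh_measurable (interp phi x - y) (grad (interp phi x) - dy).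
Proof.
have [m0 m1 m2] := interp_measurable x; have [my0 my1 my2] := my.
by split; apply: measurable_funB.
Qed.

Let interpB_mesh x x' q : D q ->
  interp phi x q = interp phi x' q + interp phi (x - x') q /\
  grad (interp phi x) q = grad (interp phi x') q + grad (interp phi (x - x')) q.
Proof.
move=> Dq; rewrite !interpE !(grad_interp phiV)// -gcombD -combD.
by rewrite [x' + _]addrC subrK.
Qed.

Let ball_norm_move x x' : (ball_norm x <= ball_norm x' + nY (x - x'))%E.
Proof.
apply: W1norm_triangle; [exact: diff_measurable|exact: interp_measurable|].
move=> q Dq; have [E dE] := interpB_mesh x x' Dq.
split; first by rewrite /= !fctE E addrAC.
by rewrite /= !fctE dE addrAC.
Qed.

Let nY_le_ball_norm x x' : (nY (x - x') <= ball_norm x + ball_norm x')%E.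
Proof.
have opp_norm : ball_norm x' =
    W1norm W p (\- (interp phi x' - y)) (fun q => - (grad (interp phi x') - dy) q).
  rewrite /ball_norm !W1norm_mesh; congr (_ + _ + _)%E; symmetry.
  - exact: LnormD_opp.
  - by rewrite -[RHS]LnormD_opp; apply: eq_LnormD.
  - by rewrite -[RHS]LnormD_opp; apply: eq_LnormD.
rewrite opp_norm; apply: W1norm_triangle; first exact: diff_measurable.
  have [m0 m1 m2] := diff_measurable x'.
  by split; apply: measurable_funN.
move=> q Dq; have [E dE] := interpB_mesh x x' Dq.
have cancel (V : zmodType) (u v w : V) : v = u + v - w - (u - w).
  by rewrite opprB addrA subrK addrAC subrr add0r.
split; first by rewrite /= !fctE E -cancel.
by rewrite /= !fctE dE -cancel.
Qed.

(** Closed by the triangle inequality and the continuity of the coordinates to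
    function map; bounded because the norm bounds the coordinates. *)
Lemma compact_Vball x0 :
  state_jac mu2 (D : set plane) phi d1 d2 b a da x0 \in unitmx ->
  Vball W M p y dy kappa (interp phi x0) ->
  compact [set x | Vball W M p y dy kappa (interp phi x)].
Proof.
move=> Jx0 [_ x0_ball]; apply: bounded_closed_compact.
  have [C C0 C_le] := coord_le_shape_norm shapes a_kinked p1 Jx0.
  exists (`|x0| + C * (2 * kappa)); split; first exact: num_real.
  move=> r r_gt x [_ x_ball] /=.
  apply: le_trans (ltW r_gt).
  have nY_le : fine (nY (x - x0)) <= 2 * kappa.
    rewrite -lee_fin fineK// (le_trans (nY_le_ball_norm x x0))//.
    by rewrite (le_trans (leeD x_ball x0_ball))// -EFinD lee_fin; lra.
  have := ler_normD (x - x0) x0; rewrite subrK => /le_trans; apply.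
  by rewrite addrC lerD2l (le_trans (C_le _))// ler_wpM2l// -nYE.
move=> x x_cl; split; first exact: interp_Vh.
have [C C0 C_le] := W1norm_interp_le.
apply/lee_addgt0Pr => e e0.
have eC0 : 0 < e / (C + 1) by rewrite divr_gt0// ltr_wpDl.
have [x' [[_ x'_ball] xx']] := x_cl _ (nbhsx_ballx x _ eC0).
rewrite (le_trans (ball_norm_move x x'))// leeD//.
rewrite (le_trans (C_le _))// lee_fin.
move: xx'; rewrite -ball_normE /ball_/= => /ltW; rewrite ler_pdivlMr ?ltr_wpDl//.
by have := normr_ge0 (x - x'); lra.
Qed.

End DiscreteNorm.

(** * Differentiability of the discrete solution operator *)

Unset Implicit Arguments.
Theorem theorem3p7 (R : realType)
  (Omega : set (R * R)) (hOmega : convex_polygon Omega)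
  (b : R * R -> R) (blow : R)
  (b_lip : [lipschitz b x | x in closure Omega])
  (blow_gt0 : 0 < blow)
  (b_ge : forall x : R * R, closure Omega x -> blow <= b x)
  (tbar : R) (a0 a1 a : R -> R)
  (a_def : a = piecewise tbar a0 a1)
  (a_ge0 : forall t, 0 <= a t)
  (a0_C2 : C2_on [set t | t <= tbar] a0)
  (a1_C2 : C2_on [set t | tbar <= t] a1)
  (a01 : a0 tbar = a1 tbar)
  (H : set R) (Th : R -> seq (3.-tuple (R * R)))
  (Th_regular : regular_family Omega H Th)
  (ubar ybar : R * R -> R) (dybar : R * R -> R * R)
  (ubar_L2 : Lp Omega 2 ubar)
  (ybar_state : weak_solution Omega b a ubar ybar dybar)
  (ptilde : R) (ptilde_ge4 : 4 <= ptilde)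
  (h1 rho kappa : R)
  (h1_gt0 : 0 < h1) (rho_gt0 : 0 < rho) (kappa_gt0 : 0 < kappa)
  (Sh : R -> (R * R -> R) -> (R * R -> R))
  (ShP : forall h, H h -> h < h1 ->
     forall u, L2cball Omega ubar rho u ->
       unique (fun y => Vball Omega (Th h) ptilde ybar dybar kappa y /\
                        discrete_state Omega (Th h) b a u y) (Sh h u))
  (h2 : R) (h2_gt0 : 0 < h2) (h2_lt : h2 < h1)
  (D_isoP : forall h, H h -> h < h2 ->
     forall y, Vball Omega (Th h) ptilde ybar dybar kappa y ->
       D_iso Omega (Th h) b a (deriv_off tbar a) y) :
  forall h, H h -> h < h2 ->
    exists dSh : (R * R -> R) -> (R * R -> R) -> (R * R -> R),
      C1_with (Lp Omega 2) (Vh Omega (Th h))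
        (Lpnorm Omega 2) (fun v => W1norm Omega ptilde v (grad v))
        (L2ball Omega ubar rho) (Sh h) dSh /\
      forall u v, L2ball Omega ubar rho u -> Lp Omega 2 v ->
        unique (fun z => Vh Omega (Th h) z /\
            forall w, Vh Omega (Th h) w ->
              Dform Omega b a (deriv_off tbar a) (Sh h u) z w =
              integral2 Omega (fun x => v x * w x))
          (dSh u v).

Proof.
move=> h Hh hh2; have hh1 : h < h1 := lt_trans hh2 h2_lt.
have [_ oW bW _ _] := hOmega.
have [_ tri _] := Th_regular.1 h Hh.
have [n [phi [phiV phi_basis]]] := Vh_basis tri.
have [b_cont [bB b_le]] := lipschitz_continuous_bounded oW bW b_lip.
have [B shapes] := mesh_shapes oW bW phiV tbar b_cont b_le.
have kinked_a := piecewise_kinked a0_C2 a1_C2 a01; rewrite -a_def in kinked_a.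
set da := deriv_off tbar a in kinked_a *.
have p1 : 1 < ptilde by rewrite (lt_le_trans _ ptilde_ge4)// ltr1n.
pose D := mesh_interior Omega (Th h).
pose Jac := state_jac mu2 (D : set (measurableTypeR R * measurableTypeR R)) phi
  (fun i => partial false (phi i)) (fun i => partial true (phi i)) b a da.
pose F := state_fun mu2 (D : set (measurableTypeR R * measurableTypeR R)) phi
  (fun i => partial false (phi i)) (fun i => partial true (phi i)) b a.
pose nX := Lpnorm Omega 2.
pose K := [set x | Vball Omega (Th h) ptilde ybar dybar kappa (interp phi x)].
have K_unit x : K x -> Jac x \in unitmx.
  move=> Kx; apply: (D_iso_unit oW tri phiV phi_basis shapes kinked_a).
  exact: D_isoP.
have F_diff x (e : R) : 0 < e -> \forall z \near (0 : 'rV[R]_n),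
    `|F (x + z) - F x - z *m Jac x| <= e * `|z|.
  exact: (state_fun_diff shapes kinked_a).
have Jac_near x (e : R) : 0 < e -> \forall y \near x, `|Jac y - Jac x| <= e.
  exact: (state_jac_near shapes kinked_a).
(* [s u] are the coordinates of the state: the only vector in [K] that [F] maps
   to the load of [u]. *)
have /choice[s sE] : forall u, exists x, L2cball Omega ubar rho u -> Sh h u = interp phi x.
  move=> u; have [uB|nuB] := pselect (L2cball Omega ubar rho u); last by exists 0.
  have [[[ShV _] _] _] := ShP h Hh hh1 u uB.
  by have [x xE] := interp_surj phi_basis ShV; exists x.
have sP u : L2cball Omega ubar rho u ->
    [/\ K (s u), F (s u) = load Omega phi u &
      forall x, K x -> F x = load Omega phi u -> x = s u].
  move=> uB; have uL2 := uB.1; have [[ball state] uniq_u] := ShP h Hh hh1 u uB.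
  have stateP := discrete_stateP oW bW tri phiV phi_basis shapes kinked_a _ uL2.
  rewrite (sE u uB) in ball state uniq_u; split => //.
    exact/stateP.
  move=> x Kx Fx; apply: (interp_inj phiV phi_basis); symmetry.
  exact: uniq_u (conj Kx ((stateP x).2 Fx)).
have ball_cball u : L2ball Omega ubar rho u -> L2cball Omega ubar rho u.
  by move=> [uL2 /ltW].
have cK : compact K.
  have ubarB : L2cball Omega ubar rho ubar.
    by split => //; rewrite subrr Lpnorm0// lee_fin ltW.
  have [Ks _ _] := sP ubar ubarB.
  apply: (compact_Vball oW tri phiV shapes kinked_a p1 _ (K_unit _ Ks) Ks).
  have [[yL dy1L dy2L _ _] _] := ybar_state.
  have [_ my _] := Lp_restrict (Th h) oW yL.
  have [_ mdy1 _] := Lp_restrict (Th h) oW dy1L.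
  have [_ mdy2 _] := Lp_restrict (Th h) oW dy2L.
  by split.
have [C1 C10 nY_le] := W1norm_interp_le oW tri phiV shapes p1.
have [C2 C20 load_le] := load_bounded oW bW tri shapes.
(* [C1] bounds the norm by the coordinates and [C2] the load by the datum, so that
   accuracy [e / (C1 * C2 + 1)] for the coordinates gives [e] for the states. *)
have scale_le (e N : R) : 0 < e -> 0 <= N -> C1 * (e / (C1 * C2 + 1) * (C2 * N)) <= e * N.
  move=> e0 N0; have C120 : 0 < C1 * C2 + 1 by rewrite ltr_wpDl// mulr_ge0.
  rewrite (_ : C1 * _ = e * N * ((C1 * C2) / (C1 * C2 + 1))); last by ring.
  by rewrite ler_piMr ?mulr_ge0 ?(ltW e0)// ler_pdivrMr// mul1r lerDl.
have two_ge1 : 1 <= 2 :> R by rewrite ler1n.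
have nX_ge0 v : (0 <= nX v)%E by exact: Lnorm_ge0.
have nX_fin v : Lp Omega 2 v -> nX v = (fine (nX v))%:E.
  by move=> /(LpP oW)[_ vfin]; rewrite fineK// ge0_fin_numE.
have load_leR v : Lp Omega 2 v -> `|load Omega phi v| <= C2 * fine (nX v).
  by move=> vL2; rewrite -lee_fin EFinM -nX_fin//; exact: load_le.
have loadD u v : Lp Omega 2 u -> Lp Omega 2 v ->
    load Omega phi (u + v) = load Omega phi u + load Omega phi v.
  move=> uL2 vL2; have := load_linear oW bW tri shapes 1 uL2 vL2.
  by rewrite !scale1r.
(* The derivative solves the equation linearized at [Sh h u] for the load of [v]. *)
exists (fun u v => interp phi (load Omega phi v *m invmx (Jac (s u)))); split; last first.
  move=> u v /ball_cball uB vL2; rewrite (sE u uB).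
  have [Ks _ _] := sP u uB.
  exact: (linearized_unique oW bW tri phiV phi_basis shapes kinked_a (K_unit _ Ks) vL2).
have F_inj u : L2cball Omega ubar rho u ->
    forall x, K x -> F x = F (s u) -> x = s u.
  by move=> uB x Kx Fx; have [_ Fs s_uniq] := sP u uB; apply: s_uniq => //; rewrite Fx.
split=> u uball; have uB := ball_cball u uball; have [Ks Fs _] := sP u uB.
  split.
    split; first by move=> v _; exact: interp_Vh.
      move=> c v w vL2 wL2; rewrite (load_linear oW bW tri shapes)//.
      by rewrite mulmxDl -scalemxAl interp_linear.
    exists (C1 * (n%:R * `|invmx (Jac (s u))| * C2)) => v vL2.
    rewrite -/(nX v) (nX_fin v vL2) -EFinM.
    apply: le_trans (nY_le _) _; rewrite lee_fin -[leRHS]mulrA ler_wpM2l//.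
    rewrite (le_trans (ler_mulmx_norm _ _))// -[leRHS]mulrA ler_wpM2l ?mulr_ge0//.
    exact: load_leR.
  move=> e e0; have e'0 : 0 < e / (C1 * C2 + 1) by rewrite divr_gt0// ltr_wpDl// mulr_ge0.
  have [r r0 r_le] := inverse_diff F_diff cK (K_unit _ Ks) (F_inj u uB) e'0.
  have [uL2 u_lt] := uball.
  have uuL2 : Lp Omega 2 (u - ubar) by exact: LpB.
  have gap : 0 < rho - fine (nX (u - ubar)).
    by rewrite subr_gt0 -lte_fin -nX_fin.
  (* The second bound keeps [u + v] in the closed ball, where [Sh h] is defined by
     the state equation. *)
  exists (Num.min (r / (C2 + 1)) (rho - fine (nX (u - ubar)))).
    by rewrite lt_min gap divr_gt0// ltr_wpDl.
  move=> v vL2; rewrite -/(nX v) (nX_fin v vL2) lte_fin lt_min => /andP[v_r v_gap].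
  have nXv0 : 0 <= fine (nX v) by rewrite fine_ge0.
  have uvB : L2cball Omega ubar rho (u + v).
    split; first exact: LpD.
    have uv_le : (nX (u + v - ubar)%R <= nX (u - ubar)%R + nX v)%E.
      by apply: Lpnorm_triangle => // q; rewrite !fctE; ring.
    rewrite (le_trans uv_le)// (nX_fin _ uuL2) (nX_fin v vL2) -EFinD lee_fin; lra.
  have [Kuv Fuv _] := sP _ uvB.
  have FB : F (s (u + v)) - F (s u) = load Omega phi v.
    by rewrite Fuv Fs loadD// addrAC subrr add0r.
  have loadv_lt : `|F (s (u + v)) - F (s u)| < r.
    rewrite FB (le_lt_trans (load_leR v vL2))//.
    move: v_r; rewrite ltr_pdivlMr ?ltr_wpDl//; lra.
  have := r_le _ Kuv loadv_lt; rewrite FB => diff_le.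
  rewrite (sE u uB) (sE _ uvB) -!interpB -EFinM.
  apply: le_trans (nY_le _) _; rewrite lee_fin.
  rewrite (le_trans _ (scale_le e _ e0 nXv0))// ler_wpM2l// (le_trans diff_le)//.
  by rewrite ler_wpM2l ?(ltW e'0)//; exact: load_leR.
move=> e e0; have e'0 : 0 < e / (C1 * C2 + 1) by rewrite divr_gt0// ltr_wpDl// mulr_ge0.
have [r r0 r_le] :=
  inverse_jacobian_continuous F_diff Jac_near cK (K_unit _ Ks) (F_inj u uB) e'0.
exists (r / (C2 + 1)); first by rewrite divr_gt0// ltr_wpDl.
move=> u' u'ball; have u'B := ball_cball u' u'ball; have [Ks' Fs' _] := sP u' u'B.
have u'uL2 : Lp Omega 2 (u' - u) by apply: LpB => //; [exact: u'B.1|exact: uB.1].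
rewrite -/(nX _) (nX_fin _ u'uL2) lte_fin => u'u_lt v vL2.
have FB : F (s u') - F (s u) = load Omega phi (u' - u).
  by have := loadD _ _ u'uL2 uB.1; rewrite subrK Fs' Fs => ->; rewrite addrK.
have load_lt : `|F (s u') - F (s u)| < r.
  rewrite FB (le_lt_trans (load_leR _ u'uL2))//.
  have := nX_ge0 (u' - u); rewrite (nX_fin _ u'uL2) lee_fin.
  by move: u'u_lt; rewrite ltr_pdivlMr ?ltr_wpDl//; lra.
have nXv0 : 0 <= fine (nX v) by rewrite fine_ge0.
rewrite -!interpB -/(nX v) (nX_fin v vL2) -EFinM.
apply: le_trans (nY_le _) _; rewrite lee_fin.
rewrite (le_trans _ (scale_le e _ e0 nXv0))// ler_wpM2l//.
rewrite (le_trans (r_le _ Ks' (K_unit _ Ks') load_lt _))//.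
by rewrite ler_wpM2l ?(ltW e'0)//; exact: load_leR.
Qed.
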